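(* There is an absolute constant $C>0$ such that the following holds. Let $d\ge2$, let $\bar\tau$ be a binary dimension tree with leaves $L(\bar\tau)=\{1,\dots,d\}$ and height $h(\bar\tau)$, let $\boldsymbol\beta\in\mathbb C^{d\times d}$ be strictly upper triangular, put $\boldsymbol\beta_s=\boldsymbol\beta+\boldsymbol\beta^\top$, and let $\epsilon>0$ and an integer $k\ge1$ be such that $$\sigma_{k+1}\big(\boldsymbol\beta_s(\tau,\bar\tau\setminus\tau)\big)\le\epsilon\,\|\boldsymbol\beta_s(\tau,\bar\tau\setminus\tau)\|_2\qquad\text{for all }\tau\in\mathcal T(\bar\tau)\setminus\{\bar\tau\}.$$ Let $\mathbf A_i\in\mathbb C^{n_i\times n_i}$ for $i=1,\dots,d$, let $\mathbf A^{(i)}=\mathbf I_{n_d}\otimes\cdots\otimes\mathbf I_{n_{i+1}}\otimes\mathbf A_i\otimes\mathbf I_{n_{i-1}}\otimes\cdots\otimes\mathbf I_{n_1}$, and let $\widehat H=\sum_{1\le i<j\le d}\beta(i,j)\,\mathbf A^{(i)}\mathbf A^{(j)}$. Then there exists a strictly upper triangular matrix $\boldsymbol\beta_k\in\mathbb C^{d\times d}$, independent of the $\mathbf A_i$, that admits an HSS decomposition on $\bar\tau$ of HSS rank $k$ and satisfies $\|\boldsymbol\beta-\boldsymbol\beta_k\|_F\le C\,h(\bar\tau)\sqrt k\,\|\boldsymbol\beta\|_F\,\epsilon$, such that the operator $$\widehat H_k=\sum_{1\le i<j\le d}\beta_k(i,j)\,\mathbf A^{(i)}\mathbf A^{(j)}\in\mathbb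 C^{(n_1\cdots n_d)\times(n_1\cdots n_d)}$$ admits a TTNO representation on $\bar\tau$ of representation rank $2+k$ and satisfies $$\|\widehat H-\widehat H_k\|_2\le C\,h(\bar\tau)\sqrt k\,\|\boldsymbol\beta\|_F\Big(\sum_{1\le i<j\le d}\|\mathbf A_i\|_2^2\|\mathbf A_j\|_2^2\Big)^{1/2}\epsilon.$$
   Context: $\|\cdot\|_2$ is the spectral norm, $\|\cdot\|_F$ the Frobenius norm, and $\sigma_{j}(\cdot)$ the $j$th largest singular value (set to $0$ if $j$ exceeds the smaller matrix dimension). Binary dimension tree: a rooted tree $\bar\tau$ with leaf set $L(\bar\tau)=\{1,\dots,d\}$ defined recursively. A tree with a single leaf $\ell$ is $\tau=\ell$. A tree with more than one leaf is $\tau=(\tau_1,\tau_2)$, where the root has two children that are roots of dimension trees $\tau_1,\tau_2$, and $L(\tau)$ is the disjoint union of $L(\tau_1)$ and $L(\tau_2)$ with $\max L(\tau_1)<\min L(\tau_2)$. Leaf sets are always nonempty sets of consecutive integers. $\mathcal T(\bar\tau)$ denotes the set of all non-leaf subtrees $\tau=(\tau_1,\tau_2)$ occurring in this recursive construction (including $\bar\tau$ itself). $d_\tau$ is the cardinality of $L(\tau)$. The height $h(\bar\tau)$ is the maximal number of edges on a path from the root to a leaf. $\boldsymbol\beta_s(\tau,\bar\tau\setminus\tau)$ is the submatrix of $\boldsymbol\beta_s$ with rows in $L(\tau)$ and columns in $\{1,\dots,d\}\setminus L(\tau)$; $\boldsymbol\beta(\tau_1,\tau_2)$ is the submatrix of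 $\boldsymbol\beta$ with rows in $L(\tau_1)$ and columns in $L(\tau_2)$. HSS decomposition: a strictly upper triangular $\boldsymbol\beta$ admits a hierarchically semi-separable (HSS) decomposition on $\bar\tau$ with ranks $k_\tau$ ($\tau$ ranging over all non-root subtrees and leaves) if there are matrices $\mathbf V_\tau\in\mathbb C^{d_\tau\times k_\tau}$ such that (1) for every $\tau=(\tau_1,\tau_2)\in\mathcal T(\bar\tau)$ there is $\mathbf S_{\tau_1,\tau_2}\in\mathbb C^{k_{\tau_1}\times k_{\tau_2}}$ with $\boldsymbol\beta(\tau_1,\tau_2)=\mathbf V_{\tau_1}\mathbf S_{\tau_1,\tau_2}\mathbf V_{\tau_2}^\top$; and (2) for every $\tau=(\tau_1,\tau_2)\in\mathcal T(\bar\tau)\setminus\{\bar\tau\}$ there is $\mathbf R_\tau\in\mathbb C^{(k_{\tau_1}+k_{\tau_2})\times k_\tau}$ with $\mathbf V_\tau=\begin{pmatrix}\mathbf V_{\tau_1}&0\\0&\mathbf V_{\tau_2}\end{pmatrix}\mathbf R_\tau$. The HSS rank of the decomposition is the largest $k_\tau$. (No full-rank conditions are imposed on the $\mathbf V_\tau$.) Tree tensor network (TTN) on $\bar\tau$ with mode sizes $N_1,\dots,N_d$ and ranks $r_\tau$ ($\tau\in\mathcal T(\bar\tau)\cup L(\bar\tau)$, with $r_{\bar\tau}=1$ for the root): the data consist of basis matrices $\mathbf U_\ell\in\mathbb C^{N_\ell\times r_\ell}$ at the leaves and transfer tensors $C_\tau\in\mathbb C^{r_{\tau_1}\times r_{\tau_2}\times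 r_\tau}$ for $\tau=(\tau_1,\tau_2)\in\mathcal T(\bar\tau)$ (no rank conditions are imposed on these). Recursively, for $\tau=(\tau_1,\tau_2)$, $\mathbf U_\tau=(\mathbf U_{\tau_2}\otimes\mathbf U_{\tau_1})\,\mathrm{Mat}_{1,2}(C_\tau)$, where $\mathrm{Mat}_{1,2}(C_\tau)\in\mathbb C^{(r_{\tau_1}r_{\tau_2})\times r_\tau}$ merges the first two indices of $C_\tau$ into a row index with the first index running fastest. The tensor $X\in\mathbb C^{N_1\times\cdots\times N_d}$ represented by the TTN is the one with $\mathrm{vec}(X)=\mathbf U_{\bar\tau}$ (vectorization with first index fastest). The representation rank of the TTN is the largest $r_\tau$ over $\tau\in\mathcal T(\bar\tau)\cup L(\bar\tau)$. TTNO: for a matrix $\widehat H\in\mathbb C^{(n_1\cdots n_d)\times(n_1\cdots n_d)}$, its reshape $H\in\mathbb C^{n_1^2\times\cdots\times n_d^2}$ is the image of $\widehat H$ under the linear bijection determined by $\mathbf B_d\otimes\cdots\otimes\mathbf B_1\mapsto\mathrm{vec}(\mathbf B_1)\circ\cdots\circ\mathrm{vec}(\mathbf B_d)$ for $\mathbf B_k\in\mathbb C^{n_k\times n_k}$ ($\circ$ is the outer product). A TTNO representation of $\widehat H$ on $\bar\tau$ of representation rank $r$ is a TTN on $\bar\tau$ with mode sizes $N_\ell=n_\ell^2$ and representation rank $r$ that represents $H$. *)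

(* Defs.v *)
From HB Require Import structures.
From mathcomp Require Import all_boot all_order all_algebra.
From mathcomp Require Import complex mxtens reals.

Set Implicit Arguments.
Unset Strict Implicit.
Unset Printing Implicit Defensive.

Import Order.TTheory GRing.Theory Num.Theory.
Local Open Scope ring_scope.
Local Open Scope sesquilinear_scope.

Notation "A *t B" := (tensmx A B)
  (at level 40, left associativity, format "A  *t  B") : ring_scope.

(** * Matrix norms and singular values *)

Section Norms.
Variable R : realType.
Local Notation C := R[i].

Definition frobenius_norm m n (A : 'M[C]_(m, n)) : R :=
  Num.sqrt (\sum_i \sum_j Normc.normc (A i j) ^+ 2).

(* [A^t* *m A] is Hermitian positive semidefinite, so [spectral_diag] lists its
   eigenvalues with multiplicity, and they are nonnegative reals. *)
Definition singular_values m n (A : 'M[C]_(m, n)) : seq R :=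
  sort >=%R [seq Num.sqrt (complex.Re (spectral_diag (A ^t* *m A) 0 i))
            | i <- enum 'I_n].

(* [j] is counted from 1.  For j > n the default 0 of [nth] is returned; for
   m < j <= n the value is 0 because [A^t* *m A] has rank at most m. *)
Definition sigma (j : nat) m n (A : 'M[C]_(m, n)) : R :=
  nth 0 (singular_values A) j.-1.

Definition spectral_norm m n (A : 'M[C]_(m, n)) : R := sigma 1 A.

End Norms.

(** * Dimension trees; the leaves 1, ..., d are numbered 0, ..., d-1 *)

Inductive dtree (d : nat) : Type :=
| DLeaf of 'I_d
| DNode of dtree d & dtree d.

Section DtreeCountable.
Variable d : nat.

Fixpoint dtree_encode (t : dtree d) : GenTree.tree 'I_d :=
  match t with
  | DLeaf l => GenTree.Leaf l
  | DNode t1 t2 => GenTree.Node 0 [:: dtree_encode t1; dtree_encode t2]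
  end.

Fixpoint dtree_decode (g : GenTree.tree 'I_d) : option (dtree d) :=
  match g with
  | GenTree.Leaf l => Some (DLeaf l)
  | GenTree.Node _ [:: g1; g2] =>
      if (dtree_decode g1, dtree_decode g2) is (Some t1, Some t2)
      then Some (DNode t1 t2) else None
  | GenTree.Node _ _ => None
  end.

Lemma dtree_encodeK : pcancel dtree_encode dtree_decode.
Proof. by elim=> //= t1 -> t2 ->. Qed.

HB.instance Definition _ := Countable.copy (dtree d) (pcan_type dtree_encodeK).

End DtreeCountable.

Section Dtree.
Variable d : nat.
Implicit Types t : dtree d.

Definition is_leaf t : bool := if t is DLeaf _ then true else false.

Fixpoint leaf_set t : {set 'I_d} :=
  match t with
  | DLeaf l => [set l]
  | DNode t1 t2 => leaf_set t1 :|: leaf_set t2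
  end.

Fixpoint ordered_leaves t : bool :=
  match t with
  | DLeaf _ => true
  | DNode t1 t2 =>
      [&& ordered_leaves t1, ordered_leaves t2 &
          [forall i in leaf_set t1, forall j in leaf_set t2, (i < j)%N]]
  end.

Definition dimension_tree t : bool :=
  ordered_leaves t && (leaf_set t == [set: 'I_d]).

Fixpoint subtrees t : seq (dtree d) :=
  t :: match t with
       | DLeaf _ => [::]
       | DNode t1 t2 => subtrees t1 ++ subtrees t2
       end.

Fixpoint height t : nat :=
  match t with
  | DLeaf _ => 0
  | DNode t1 t2 => (maxn (height t1) (height t2)).+1
  end.

(* In a dimension tree this is [#|leaf_set t|]; unlike the cardinal, it reduces
   to a sum on nodes, so that block matrices need no cast. *)
Fixpoint nleaves t : nat :=
  match t with
  | DLeaf _ => 1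
  | DNode t1 t2 => nleaves t1 + nleaves t2
  end.

(* The i-th leaf of [t] from the left. *)
Fixpoint leaf_at t : 'I_(nleaves t) -> 'I_d :=
  match t return 'I_(nleaves t) -> 'I_d with
  | DLeaf l => fun _ => l
  | DNode t1 t2 => fun i =>
      match split i with
      | inl i1 => leaf_at i1
      | inr i2 => leaf_at i2
      end
  end.

End Dtree.

(** * Hierarchically semi-separable matrices *)

Section HSS.
Variables (R : realType) (d : nat).
Local Notation C := R[i].
Implicit Types (t : dtree d) (B : 'M[C]_d).

Definition strictly_upper B : Prop :=
  forall i j : 'I_d, (j <= i)%N -> B i j = 0.

(* B(t1, t2) *)
Definition tree_block B t1 t2 : 'M[C]_(nleaves t1, nleaves t2) :=
  mxsub (@leaf_at d t1) (@leaf_at d t2) B.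

(* B(t, tbar \ t) *)
Definition outer_block B t : 'M[C]_(nleaves t, #|~: leaf_set t|) :=
  mxsub (@leaf_at d t) (fun j => enum_val j) B.

(* The ranks and the matrices [V t] are indexed by all trees, but only their
   values at the non-root subtrees of [tbar] are constrained. *)
Definition has_hss (tbar : dtree d) B (hss_rank : nat) : Prop :=
  exists (k : dtree d -> nat) (V : forall t, 'M[C]_(nleaves t, k t)),
  [/\ forall t1 t2, DNode t1 t2 \in subtrees tbar ->
        exists S : 'M[C]_(k t1, k t2),
          tree_block B t1 t2 = V t1 *m S *m (V t2)^T,
      forall t1 t2, DNode t1 t2 \in subtrees tbar -> DNode t1 t2 != tbar ->
        exists T : 'M[C]_(k t1 + k t2, k (DNode t1 t2)),
          V (DNode t1 t2) = block_mx (V t1) 0 0 (V t2) *m T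
    & (\max_(t <- subtrees tbar | t != tbar) k t)%N = hss_rank].

End HSS.

(** * Kronecker products and vectorization *)

Section Kronecker.
Variable K : comNzRingType.

Definition ord_init d (i : 'I_d) : 'I_d.+1 := widen_ord (leqnSn d) i.

Fixpoint kron_dim d : ('I_d -> nat) -> nat :=
  match d with
  | 0 => fun _ => 1%N
  | d'.+1 => fun n => (n ord_max * kron_dim (fun i => n (ord_init i)))%N
  end.

(* B_(d-1) *t ... *t B_1 *t B_0 *)
Fixpoint kron d :
    forall n : 'I_d -> nat, (forall i, 'M[K]_(n i)) -> 'M[K]_(kron_dim n) :=
  match d with
  | 0 => fun _ _ => 1%:M
  | d'.+1 => fun n B => B ord_max *t kron (fun i => B (ord_init i))
  end.

(* The position of a multi-index in the vectorization with first index
   fastest; see [vec_indexE]. *)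
Fixpoint vec_index d :
    forall n : 'I_d -> nat, (forall i, 'I_(n i)) -> 'I_(kron_dim n) :=
  match d with
  | 0 => fun _ _ => ord0
  | d'.+1 => fun n m =>
      mxtens_index (m ord_max, vec_index (fun i => m (ord_init i)))
  end.

Lemma kron_dimE d (n : 'I_d -> nat) : kron_dim n = (\prod_i n i)%N.
Proof.
elim: d n => [|d IH] n /=; first by rewrite big_ord0.
by rewrite big_ord_recr IH mulnC.
Qed.

Lemma vec_indexE d (n : 'I_d -> nat) (m : forall i, 'I_(n i)) :
  vec_index m = (\sum_i m i * \prod_(j < d | j < i) n j)%N :> nat.
Proof.
elim: d n m => [|d IH] n m /=; first by rewrite big_ord0.
rewrite big_ord_recr /= addnC IH kron_dimE; congr (_ + _)%N.
  apply: eq_bigr => i _; congr (_ * _)%N.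
  by rewrite [RHS]big_mkcond big_ord_recr /= ltnNge ltnW //= muln1 -big_mkcond.
congr (_ * _)%N.
rewrite [RHS]big_mkcond big_ord_recr /= ltnn muln1.
by apply: eq_bigr => i _; rewrite ltn_ord.
Qed.

Lemma kronE d (n : 'I_d -> nat) (B : forall i, 'M[K]_(n i))
    (a b : forall i, 'I_(n i)) :
  kron B (vec_index a) (vec_index b) = \prod_i B i (a i) (b i).
Proof.
elim: d n B a b => [|d IH] n B a b /=; first by rewrite mxE big_ord0.
by rewrite tensmxE IH big_ord_recr mulrC.
Qed.

(* vec(B), with entry (i, j) of [B] at position [i + n * j]; [mxvec] is
   row-major. *)
Definition vec_mx_col n (B : 'M[K]_n) : 'cV[K]_(n * n) :=
  \col_p B (mxtens_unindex p).2 (mxtens_unindex p).1.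

(* The d-way tensor with mode sizes [N]. *)
Definition tensor d (N : 'I_d -> nat) : Type := (forall i, 'I_(N i)) -> K.

(* A mode index of size n^2 is [row + n * column], so [.2] is the row part.
   [reshape] is linear in [H] and sends Kronecker products to outer products of
   vectorizations ([reshape_linear], [reshape_kron]), which determines it. *)
Definition reshape d (n : 'I_d -> nat) (H : 'M[K]_(kron_dim n)) :
    tensor (fun i => n i * n i)%N :=
  fun m => H (vec_index (fun i => (mxtens_unindex (m i)).2))
             (vec_index (fun i => (mxtens_unindex (m i)).1)).

Lemma reshape_linear d (n : 'I_d -> nat) (a : K) (G H : 'M[K]_(kron_dim n)) m :
  reshape (a *: G + H) m = a * reshape G m + reshape H m.
Proof. by rewrite /reshape !mxE. Qed.

Lemma reshape_kron d (n : 'I_d -> nat) (B : forall i, 'M[K]_(n i)) m :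
  reshape (kron B) m = \prod_i vec_mx_col (B i) (m i) 0.
Proof.
by rewrite /reshape kronE; apply: eq_bigr => i _; rewrite mxE.
Qed.

End Kronecker.

(** * Tree tensor networks *)

Section TTN.
Variables (R : realType) (d : nat).
Local Notation C := R[i].

(* Ranks, bases and transfer tensors are indexed by all trees, but only their
   values at the subtrees of the given tree matter. *)
Record ttn (N : 'I_d -> nat) := TTN {
  ttn_rank : dtree d -> nat;
  ttn_basis : forall l : 'I_d, 'M[C]_(N l, ttn_rank (DLeaf l));
  ttn_transfer : forall t1 t2 : dtree d,
    'I_(ttn_rank t1) -> 'I_(ttn_rank t2) -> 'I_(ttn_rank (DNode t1 t2)) -> C
}.

(* Mat_{1,2}: the row index is [i1 + r1 * i2]. *)
Definition mat12 r1 r2 r (T : 'I_r1 -> 'I_r2 -> 'I_r -> C) :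
    'M[C]_(r2 * r1, r) :=
  \matrix_(p, j) T (mxtens_unindex p).2 (mxtens_unindex p).1 j.

Fixpoint tree_dim (N : 'I_d -> nat) (t : dtree d) : nat :=
  match t with
  | DLeaf l => N l
  | DNode t1 t2 => tree_dim N t2 * tree_dim N t1
  end.

Fixpoint ttn_mx N (X : ttn N) (t : dtree d) :
    'M[C]_(tree_dim N t, ttn_rank X t) :=
  match t with
  | DLeaf l => ttn_basis X l
  | DNode t1 t2 =>
      (ttn_mx X t2 *t ttn_mx X t1) *m mat12 (@ttn_transfer N X t1 t2)
  end.

(* [vec(Y) = U_tbar].  The cast identifies the row dimension of [U_tbar] with
   the product of the mode sizes, and forces the root rank to be 1. *)
Definition ttn_represents (tbar : dtree d) N (X : ttn N) (Y : tensor C N) :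
    Prop :=
  exists e : (tree_dim N tbar = kron_dim N) * (ttn_rank X tbar = 1%N),
  forall m, castmx e (ttn_mx X tbar) (vec_index m) 0 = Y m.

Definition representation_rank (tbar : dtree d) N (X : ttn N) : nat :=
  \max_(t <- subtrees tbar) ttn_rank X t.

Definition has_ttno (tbar : dtree d) (n : 'I_d -> nat)
    (H : 'M[C]_(kron_dim n)) (r : nat) : Prop :=
  exists X : ttn (fun i => n i * n i)%N,
    representation_rank tbar X = r /\ ttn_represents tbar X (reshape H).

(* A^(i) *)
Definition one_site (n : 'I_d -> nat) (A : forall i, 'M[C]_(n i)) (i : 'I_d) :
    'M[C]_(kron_dim n) :=
  kron (fun j => if j == i then A j else 1%:M).

Definition pair_operator (n : 'I_d -> nat) (B : 'M[C]_d)
    (A : forall i, 'M[C]_(n i)) : 'M[C]_(kron_dim n) :=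
  \sum_(i < d) \sum_(j < d | (i < j)%N)
    B i j *: (one_site A i *m one_site A j).

End TTN.

(* Main.v *)
Require Import Defs.
From mathcomp Require Import all_boot all_order all_algebra.
From mathcomp Require Import complex mxtens reals ring zify.

Set Implicit Arguments.
Unset Strict Implicit.
Unset Printing Implicit Defensive.

Import Order.TTheory GRing.Theory Num.Theory.
Local Open Scope ring_scope.
Local Open Scope sesquilinear_scope.

(** Write beta_s = beta + beta^T, and let B_t be the d x d matrix obtained from
    beta_s by keeping the rows in the leaf set of t and the columns outside it.
    From the leaves upwards every subtree t gets an orthogonal projector P_t of
    rank at most k: at a node (t1, t2) the matrix (P_t1 + P_t2) B_t has rank at
    most 2k, and P_t projects onto its left singular vectors with singular value
    above eps |B_t|_F.  Compressing B_t by a projector does not create new large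
    singular values, so there are at most k of these vectors, and what is thrown
    away at t is at most 2k eps^2 |B_t|_F^2 in squared Frobenius norm.  The
    approximation replaces each block beta(t1, t2) by P_t1 beta P_t2^T.  The
    losses at different nodes are mutually orthogonal, so their squares add up;
    since the B_t with t on a fixed level have disjoint rows, the sum is at most
    2k eps^2 (h + 1) |beta_s|_F^2, and C = 4 suffices.  Factoring P_t = V_t Y_t
    gives the nested bases of the HSS decomposition, and also the TTNO, whose
    2 + k columns at t are the identity, the interactions inside t, and the
    one-site operators weighted by the k columns of V_t.  The operator estimate
    is Cauchy-Schwarz: |sum_p c_p w_p|^2 <= sum_p |c_p|^2 sum_p |w_p|^2. *)

(** * Frobenius norms and truncated singular value decompositions *)

Section FrobeniusSquare.
Variable C : numClosedFieldType.

Lemma adjmxM m n p (A : 'M[C]_(m, n)) (B : 'M[C]_(n, p)) :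
  (A *m B)^t* = B^t* *m A^t*.
Proof. by rewrite trmx_mul map_mxM. Qed.

Lemma adjmxD m n (A B : 'M[C]_(m, n)) : (A + B)^t* = A^t* + B^t*.
Proof. by rewrite linearD /= map_mxD. Qed.

Lemma adjmxB m n (A B : 'M[C]_(m, n)) : (A - B)^t* = A^t* - B^t*.
Proof. by rewrite linearB /= map_mxB. Qed.

(* The squared Frobenius norm, valued in [C] so that it can be computed as a
   trace without taking real parts. *)
Definition fsq m n (A : 'M[C]_(m, n)) : C := \tr (A *m A^t*).

Lemma fsqE m n (A : 'M[C]_(m, n)) : fsq A = \sum_i \sum_j `|A i j| ^+ 2.
Proof.
apply: eq_bigr => i _; rewrite mxE; apply: eq_bigr => j _.
by rewrite !mxE normCK.
Qed.

Lemma fsq_ge0 m n (A : 'M[C]_(m, n)) : 0 <= fsq A.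
Proof.
by rewrite fsqE; do 2 (apply: sumr_ge0 => ? _); rewrite exprn_ge0.
Qed.

Lemma fsq0 m n : fsq (0 : 'M[C]_(m, n)) = 0.
Proof. by rewrite /fsq mul0mx mxtrace0. Qed.

Lemma fsq_eq0 m n (A : 'M[C]_(m, n)) : (fsq A == 0) = (A == 0).
Proof.
apply/eqP/eqP => [|->]; last exact: fsq0.
rewrite fsqE => /psumr_eq0P A0; apply/matrixP => i j; rewrite mxE.
have /psumr_eq0P Ai : \sum_j `|A i j| ^+ 2 = 0.
  by apply: A0 => // l _; apply: sumr_ge0 => ? _; rewrite exprn_ge0.
apply/eqP; rewrite -normr_eq0 -sqrf_eq0; apply/eqP/Ai => // l _.
by rewrite exprn_ge0.
Qed.

Lemma fsq_tr m n (A : 'M[C]_(m, n)) : fsq A^T = fsq A.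
Proof.
rewrite !fsqE exchange_big; apply: eq_bigr => i _; apply: eq_bigr => j _.
by rewrite mxE.
Qed.

Lemma fsq_adj m n (A : 'M[C]_(m, n)) : fsq (A^t*) = fsq A.
Proof. by rewrite /fsq trmxCK mxtrace_mulC. Qed.

(** Orthogonal column spaces: after a cyclic permutation both cross terms are traces of zero
    matrices. *)
Lemma fsq_pythagoras m n (A B : 'M[C]_(m, n)) :
  A^t* *m B = 0 -> fsq (A + B) = fsq A + fsq B.
Proof.
move=> AB; have BA : B^t* *m A = 0.
  by rewrite -[LHS]trmxCK adjmxM trmxCK AB trmx0 map_mx0.
rewrite /fsq adjmxD mulmxDl !mulmxDr !mxtraceD.
rewrite (mxtrace_mulC A (B^t*)) (mxtrace_mulC B (A^t*)) AB BA !mxtrace0.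
by rewrite addr0 add0r.
Qed.

Lemma fsqD_le m n (A B : 'M[C]_(m, n)) : fsq (A + B) <= 2 * (fsq A + fsq B).
Proof.
rewrite !fsqE -big_split mulr_sumr; apply: ler_sum => i _ /=.
rewrite -big_split mulr_sumr; apply: ler_sum => j _ /=; rewrite mxE.
have n0 (x : C) : `|x| \is Num.real by exact: normr_real.
apply: (@le_trans _ _ ((`|A i j| + `|B i j|) ^+ 2)).
  by rewrite ler_pXn2r ?nnegrE ?addr_ge0 ?ler_normD.
rewrite -subr_ge0.
have -> : 2 * (`|A i j| ^+ 2 + `|B i j| ^+ 2) - (`|A i j| + `|B i j|) ^+ 2
   = (`|A i j| - `|B i j|) ^+ 2.
  by ring.
by rewrite real_exprn_even_ge0 // realB.
Qed.

Definition is_oproj n (P : 'M[C]_n) := (P^t* = P) /\ (P *m P = P).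

Lemma fsq_split n p (P : 'M[C]_n) (X : 'M[C]_(n, p)) :
  is_oproj P -> fsq X = fsq (P *m X) + fsq ((1%:M - P) *m X).
Proof.
move=> [Ph PP]; rewrite -fsq_pythagoras.
  by rewrite -mulmxDl subrKC mul1mx.
by rewrite adjmxM Ph -mulmxA (mulmxA P) mulmxBr mulmx1 PP subrr mul0mx mulmx0.
Qed.

Lemma fsq_proj_le n p (P : 'M[C]_n) (X : 'M[C]_(n, p)) :
  is_oproj P -> fsq (P *m X) <= fsq X.
Proof. by move=> /(fsq_split X) ->; rewrite lerDl fsq_ge0. Qed.

Lemma is_oprojD n (P Q : 'M[C]_n) :
  is_oproj P -> is_oproj Q -> P *m Q = 0 -> is_oproj (P + Q).
Proof.
move=> [Ph PP] [Qh QQ] PQ; have QP : Q *m P = 0.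
  by rewrite -Qh -Ph -adjmxM PQ trmx0 map_mx0.
split; first by rewrite adjmxD Ph Qh.
by rewrite mulmxDl !mulmxDr PP QQ PQ QP addr0 add0r.
Qed.

Lemma fsq_rows m n (A : 'M[C]_(m, n)) : fsq A = \sum_i fsq (row i A).
Proof.
rewrite fsqE; apply: eq_bigr => i _; rewrite fsqE big_ord1.
by apply: eq_bigr => j _; rewrite mxE.
Qed.

Lemma fsq_unitary m p (U : 'M[C]_m) (X : 'M[C]_(m, p)) :
  U^t* *m U = 1%:M -> fsq (U *m X) = fsq X.
Proof.
by move=> UU; rewrite /fsq adjmxM mulmxA mxtrace_mulC !mulmxA UU mul1mx.
Qed.

(** Isometric inclusion of the coordinate subspace of [J]; times its transpose it is the coordinate
    projector. *)
Definition coord_emb n (J : {set 'I_n}) : 'M[C]_(n, #|J|) :=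
  \matrix_(i, p) (i == enum_val p)%:R.

Lemma coord_embE n (J : {set 'I_n}) (i j : 'I_n) :
  (coord_emb J *m (coord_emb J)^T) i j = ((i == j) && (i \in J))%:R.
Proof.
rewrite mxE; case: (boolP (i \in J)) => iJ; last first.
  rewrite andbF big1 // => p _; rewrite !mxE.
  by case: eqP iJ => [->|]; rewrite ?enum_valP // mul0r.
rewrite (bigD1 (enum_rank_in iJ i)) //= !mxE enum_rankK_in // eqxx mul1r.
rewrite big1 ?addr0 ?andbT 1?eq_sym // => p pi; rewrite !mxE.
case: eqP => [ip|]; last by rewrite mul0r.
by case/eqP: pi; apply: enum_val_inj; rewrite enum_rankK_in.
Qed.

Lemma rank_diag_le n (J : {set 'I_n}) (D : 'rV[C]_n) :
  (forall j, j \notin J -> D 0 j = 0) -> (\rank (diag_mx D) <= #|J|)%N.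
Proof.
move=> D0; have -> : diag_mx D = coord_emb J *m ((coord_emb J)^T *m diag_mx D).
  rewrite mulmxA; apply/matrixP => i j; rewrite mul_mx_diag [RHS]mxE coord_embE mxE.
  case: (altP (i =P j)) => [->|_] /=; last by rewrite mul0r.
  by case: (boolP (j \in J)) => [_|/D0 ->]; rewrite ?mul1r ?mulr0 ?mul0rn.
exact: mulmx_max_rank.
Qed.

(** * Spectral decomposition of the Gram matrix and singular value truncation *)

Section Gram.
Variables (m n : nat) (A : 'M[C]_(m, n)).

(** The rows are the adjoints of right singular vectors of [A], and [gram_eig] lists the squared
    singular values without ordering them. *)
Definition gram_basis := spectralmx (A^t* *m A).
Definition gram_eig j := spectral_diag (A^t* *m A) 0 j.
Local Notation U := gram_basis.
Local Notation lam := gram_eig.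

Lemma gram_basisK : U *m U^t* = 1%:M.
Proof. exact/unitarymxP/spectral_unitarymx. Qed.

Lemma gram_basisKV : U^t* *m U = 1%:M.
Proof. exact/mulmx1C/gram_basisK. Qed.

Lemma gramE : A^t* *m A = U^t* *m diag_mx (spectral_diag (A^t* *m A)) *m U.
Proof.
rewrite /U -(invmx_unitary (spectral_unitarymx _)).
by apply/orthomx_spectralP/normalmxP; rewrite adjmxM trmxCK.
Qed.

(** Diagonalising the Gram matrix inside the trace weights each singular coordinate of [X] by its
    eigenvalue. The spectral estimates below are read off from this formula. *)
Lemma fsq_gram p (X : 'M[C]_(n, p)) :
  fsq (A *m X) = \sum_j lam j * fsq (row j (U *m X)).
Proof.
rewrite {1}/fsq adjmxM mxtrace_mulC !mulmxA -(mulmxA _ (A^t*)) gramE !mulmxA.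
rewrite -adjmxM -(mulmxA _ U X) mxtrace_mulC mulmxA; apply: eq_bigr => j _.
rewrite mul_mx_diag mxE mulrC; congr (_ * _).
rewrite fsqE big_ord1 mxE; apply: eq_bigr => q _.
by rewrite !mxE normCK.
Qed.

Lemma fsq_row_basis p (X : 'M[C]_(n, p)) : \sum_j fsq (row j (U *m X)) = fsq X.
Proof. by rewrite -fsq_rows fsq_unitary // gram_basisKV. Qed.

Lemma gram_eigE j : lam j = fsq (A *m col j (U^t*)).
Proof.
rewrite fsq_gram colE mulmxA gram_basisK mul1mx (bigD1 j) //= big1 => [|i ij].
  rewrite addr0 fsqE !big_ord1 !mxE eqxx normr1 expr1n mulr1.
  by [].
by rewrite fsqE !big_ord1 !mxE (negPf ij) normr0 expr0n mulr0.
Qed.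

Lemma gram_eig_ge0 j : 0 <= lam j.
Proof. by rewrite gram_eigE fsq_ge0. Qed.

Lemma fsq_gram_col j : fsq (col j (U^t*)) = 1.
Proof.
rewrite -fsq_row_basis (bigD1 j) //= big1 => [|i ij].
  rewrite colE mulmxA gram_basisK mul1mx addr0 fsqE !big_ord1 !mxE eqxx.
  by rewrite normr1 expr1n.
by rewrite colE mulmxA gram_basisK mul1mx fsqE !big_ord1 !mxE (negPf ij) normr0 expr0n.
Qed.

Lemma fsq_le_eig (c : C) p (X : 'M[C]_(n, p)) :
  (forall j, lam j <= c) -> fsq (A *m X) <= c * fsq X.
Proof.
move=> lec; rewrite fsq_gram -fsq_row_basis mulr_sumr.
by apply: ler_sum => j _; rewrite ler_wpM2r ?fsq_ge0.
Qed.

Lemma eig_le_fsq (c : C) j :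
  (forall v : 'cV[C]_n, fsq (A *m v) <= c * fsq v) -> lam j <= c.
Proof. by rewrite gram_eigE => /(_ (col j (U^t*))); rewrite fsq_gram_col mulr1. Qed.

(** One half of Courant-Fischer: if there were more large eigenvalues than the rank of [X], the span
    of their eigenvectors would meet the kernel of [X], where [A] is assumed small. *)
Lemma card_eig_gt (c : C) p (X : 'M[C]_(p, n)) : 0 <= c ->
  (forall v : 'cV[C]_n, X *m v = 0 -> fsq (A *m v) <= c * fsq v) ->
  (#|[set j | (c < lam j)%R]| <= \rank X)%N.
Proof.
move=> c0 Xc; set J := [set j | _]; rewrite leqNgt; apply/negP => rJ.
(* [Y] is [X] on the span of the eigenvectors with index in [J]. It has more columns than its rank,
   hence a nonzero kernel vector. *)
pose E := coord_emb J; pose Y := X *m U^t* *m E.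
have rY : (\rank Y < #|J|)%N.
  apply: leq_ltn_trans rJ; by rewrite /Y -mulmxA mxrankM_maxl.
have : kermx Y^T != 0 by rewrite -mxrank_eq0 mxrank_ker mxrank_tr -lt0n subn_gt0.
case/rowV0Pn => w /sub_kermxP wY w0.
pose z := E *m w^T.
have z0 : z != 0.
  apply: contraNneq w0 => z0; apply/eqP/rowP => a; rewrite mxE.
  move/matrixP/(_ (enum_val a) 0): z0; rewrite !mxE (bigD1 a) //= !mxE eqxx mul1r.
  rewrite big1 ?addr0 // => q qp; rewrite !mxE.
  by rewrite (inj_eq enum_val_inj) eq_sym (negPf qp) mul0r.
have zJ j : j \notin J -> row j z = 0.
  move=> jJ; apply/rowP => i; rewrite !mxE big1 // => a _; rewrite !mxE.
  by case: eqP jJ => [->|]; rewrite ?enum_valP // mul0r.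
have Uz : U *m (U^t* *m z) = z by rewrite mulmxA gram_basisK mul1mx.
have /Xc : X *m (U^t* *m z) = 0.
  by rewrite !mulmxA -(mulmxA _ E) mulmxA -[LHS]trmxK trmx_mul trmxK wY trmx0.
(* In the eigenbasis the assumed inequality makes the sum of (lam_j - c) |z_j|^2 at most 0, yet its
   terms are nonnegative since [z] vanishes off [J]. Hence each term is 0, and [z] vanishes on [J]
   too. *)
rewrite fsq_gram -fsq_row_basis Uz mulr_sumr -subr_le0 -sumrB.
set S := \sum_i _; have S0 : 0 <= S.
  apply: sumr_ge0 => j _; rewrite -mulrBl.
  case: (boolP (j \in J)) => [|/zJ ->]; last by rewrite fsq0 mulr0.
  by rewrite inE => /ltW cl; rewrite mulr_ge0 ?subr_ge0 ?fsq_ge0.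
move=> S0'; have /eqP : S = 0 by apply/eqP; rewrite eq_le S0 S0'.
rewrite psumr_eq0 => [/allP Sj|j _]; last first.
  rewrite -mulrBl.
  case: (boolP (j \in J)) => [|/zJ ->]; last by rewrite fsq0 mulr0.
  by rewrite inE => /ltW cl; rewrite mulr_ge0 ?subr_ge0 ?fsq_ge0.
case/eqP: z0; apply/row_matrixP => j; rewrite row0.
case: (boolP (j \in J)) => [|/zJ //].
rewrite inE => cl; move: (Sj j (mem_index_enum _)) => /=.
by rewrite -mulrBl mulf_eq0 subr_eq0 (gt_eqF cl) fsq_eq0 => /eqP.
Qed.

Lemma card_eig_gt0 : (#|[set j | (0 < lam j)%R]| <= \rank A)%N.
Proof. by apply: card_eig_gt => // v ->; rewrite fsq0 mul0r. Qed.

(** Converse of [card_eig_gt]: [X] reads the coordinates along the large eigenvectors. This form of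
    a singular value gap passes at once to a compression of [A] by a projector. *)
Lemma low_rank_annihilator (c : C) : 0 <= c ->
  exists2 X : 'M[C]_n, (\rank X <= #|[set j | (c < lam j)%R]|)%N &
  forall v : 'cV[C]_n, X *m v = 0 -> fsq (A *m v) <= c * fsq v.
Proof.
move=> c0; set J := [set j | _].
exists (diag_mx (\row_j (j \in J)%:R) *m U).
  apply: leq_trans (mxrankM_maxl _ _) _; apply: rank_diag_le => j /negPf jJ.
  by rewrite mxE jJ.
move=> v; rewrite -mulmxA mul_diag_mx => /matrixP Uv.
rewrite fsq_gram -fsq_row_basis mulr_sumr; apply: ler_sum => j _.
case: (boolP (j \in J)) => [jJ|].
  suff -> : row j (U *m v) = 0 by rewrite fsq0 !mulr0.
  apply/rowP => i; have := Uv j i.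
  by rewrite [LHS in LHS = _ -> _]mxE mxE jJ mul1r !mxE => ->.
rewrite inE -real_leNgt ?ger0_real ?gram_eig_ge0 // => lc.
by rewrite ler_wpM2r ?fsq_ge0.
Qed.

(** Truncated pseudo-inverse of the Gram matrix. In [top_proj] it normalises the left singular
    vectors without taking square roots. *)
Definition gram_pinv (c : C) : 'rV[C]_n :=
  \row_j if c < lam j then (lam j)^-1 else 0.

(* Projector onto the left singular vectors of [A] whose squared singular value
   exceeds [c]. *)
Definition top_proj (c : C) : 'M[C]_m :=
  A *m U^t* *m diag_mx (gram_pinv c) *m U *m A^t*.

Section TopProj.
Variable c : C.
Hypothesis c_ge0 : 0 <= c.

Let kept_gt0 j : c < lam j -> 0 < lam j.
Proof. exact: le_lt_trans. Qed.

(** Truncating on the left equals truncating on the right: the eigenvalue produced by the Gram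
    matrix cancels its inverse on the kept indices. *)
Lemma top_proj_mul :
  top_proj c *m A = A *m U^t* *m diag_mx (\row_j (c < lam j)%R%:R) *m U.
Proof.
rewrite /top_proj -mulmxA gramE !mulmxA -(mulmxA _ U) gram_basisK mulmx1.
congr (_ *m _); rewrite -mulmxA; congr (_ *m _).
apply/matrixP => i j; rewrite mul_mx_diag !mxE.
case: (altP (i =P j)) => [->|_]; rewrite ?mulr1n ?mulr0n ?mul0r //.
by case: ifP => [/kept_gt0 l0|_]; rewrite ?mul0r // mulVf // gt_eqF.
Qed.

Lemma top_proj_oproj : is_oproj (top_proj c).
Proof.
split.
  rewrite /top_proj !adjmxM !trmxCK !mulmxA; do 2 congr (_ *m _).
  congr (_ *m _); apply/matrixP => i j; rewrite !mxE eq_sym.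
  case: (altP (i =P j)) => [->|_]; rewrite ?mulr1n ?mulr0n ?rmorph0 //.
  case: ifP => // _; rewrite ?rmorph0 // fmorphV; congr (_^-1).
  by apply/CrealP/ger0_real/gram_eig_ge0.
rewrite {2}/top_proj !mulmxA top_proj_mul; do 2 congr (_ *m _).
rewrite -!mulmxA (mulmxA U) gram_basisK mul1mx.
congr (_ *m (_ *m _)).
apply/matrixP => i j; rewrite mul_diag_mx !mxE.
case: (altP (i =P j)) => [->|_]; rewrite ?mulr1n ?mulr0n ?mulr0 //.
by case: ifP => _; rewrite ?mul1r ?mul0r.
Qed.

(** The range of [top_proj] lies in that of [A]. Both the support and the nestedness of the tree
    projectors come from this. *)
Lemma top_proj_absorb (Q : 'M[C]_m) :
  Q *m A = A -> Q *m top_proj c = top_proj c.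
Proof. by move=> QA; rewrite /top_proj !mulmxA QA. Qed.

Lemma rank_top_proj : (\rank (top_proj c) <= #|[set j | (c < lam j)%R]|)%N.
Proof.
apply: leq_trans (mxrankM_maxl _ _) _; apply: leq_trans (mxrankM_maxl _ _) _.
apply: leq_trans (mxrankM_maxr _ _) _; apply: rank_diag_le => j.
by rewrite inE mxE => /negPf ->.
Qed.

(** Only the discarded nonzero eigenvalues contribute: each is at most [c], and there are at most
    \rank A nonzero ones. *)
Lemma fsq_top_proj : fsq (A - top_proj c *m A) <= c *+ \rank A.
Proof.
rewrite top_proj_mul -!mulmxA -[A in A - _]mulmx1 -mulmxBr fsq_gram.
apply: (@le_trans _ _ (\sum_(j in [set j | 0 < lam j]) c)); last first.
  by rewrite sumr_const ler_wpMn2l // card_eig_gt0.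
rewrite [leRHS]big_mkcond; apply: ler_sum => j _ /=; rewrite inE.
case: ifP => [l0|]; last first.
  rewrite lt_neqAle gram_eig_ge0 andbT eq_sym => /negbFE/eqP ->.
  by rewrite mul0r.
rewrite mulmxBr mulmx1 (mulmxA U) gram_basisK mul1mx.
have fU : fsq (row j U) = 1.
  rewrite -fsq_adj; rewrite -(fsq_gram_col j); congr fsq.
  by apply/matrixP => a b; rewrite !mxE.
case: (boolP (c < lam j)) => cl.
  suff -> : row j (U - diag_mx (\row_j (c < lam j)%R%:R) *m U) = 0.
    by rewrite fsq0 mulr0.
  by apply/rowP => i; rewrite mul_diag_mx !mxE cl mul1r subrr.
suff -> : row j (U - diag_mx (\row_j (c < lam j)%R%:R) *m U) = row j U.
  by rewrite fU mulr1 real_leNgt ?ger0_real ?gram_eig_ge0.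
by apply/rowP => i; rewrite mul_diag_mx !mxE (negPf cl) mul0r subr0.
Qed.

End TopProj.
End Gram.
End FrobeniusSquare.

(** * Coordinate projectors *)

Section CoordProj.
Variables (C : numClosedFieldType) (d : nat).
Implicit Types S T : {set 'I_d}.

Definition coord_proj S : 'M[C]_d := diag_mx (\row_i (i \in S)%:R).

Lemma coord_projlE S n (X : 'M[C]_(d, n)) i j :
  (coord_proj S *m X) i j = (i \in S)%:R * X i j.
Proof. by rewrite mul_diag_mx !mxE. Qed.

Lemma coord_projrE S n (X : 'M[C]_(n, d)) i j :
  (X *m coord_proj S) i j = (j \in S)%:R * X i j.
Proof. by rewrite mul_mx_diag !mxE mulrC. Qed.

Lemma coord_proj_tr S : (coord_proj S)^T = coord_proj S.
Proof. exact: tr_diag_mx. Qed.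

Lemma coord_projM S T : coord_proj S *m coord_proj T = coord_proj (S :&: T).
Proof.
apply/matrixP => i j; rewrite coord_projlE !mxE inE.
case: (altP (i =P j)) => [->|_]; rewrite ?mulr1n ?mulr0n ?mulr0 //.
by rewrite -natrM mulnb.
Qed.

Lemma coord_proj_oproj S : is_oproj (coord_proj S).
Proof.
split; last by rewrite coord_projM setIid.
by apply/matrixP => i j; rewrite coord_proj_tr !mxE -mulrnA conjC_nat.
Qed.

Lemma coord_proj0 : coord_proj set0 = 0.
Proof. by apply/matrixP => i j; rewrite !mxE inE mul0rn. Qed.

Lemma coord_projT : coord_proj setT = 1%:M.
Proof. by apply/matrixP => i j; rewrite !mxE inE. Qed.

Lemma coord_projU S T :
  [disjoint S & T] -> coord_proj (S :|: T) = coord_proj S + coord_proj T.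
Proof.
move=> dST; apply/matrixP => i j; rewrite !mxE -mulrnDl -natrD inE.
by case: (boolP (i \in S)) => iS //=; rewrite (disjointFr dST iS).
Qed.

Lemma coord_proj_disjoint S T :
  [disjoint S & T] -> coord_proj S *m coord_proj T = 0.
Proof. by rewrite coord_projM -setI_eq0 => /eqP ->; exact: coord_proj0. Qed.

Lemma coord_proj_sub S T : S \subset T ->
  coord_proj S *m coord_proj T = coord_proj S.
Proof. by rewrite coord_projM => /setIidPl ->. Qed.

Lemma coord_proj_supset S T : S \subset T ->
  coord_proj T *m coord_proj S = coord_proj S.
Proof. by rewrite coord_projM => /setIidPr ->. Qed.

Lemma is_oprojC (P : 'M[C]_d) : is_oproj P -> is_oproj (1%:M - P).
Proof.
move=> [Ph PP]; split; first by rewrite adjmxB Ph trmx1 map_mx1.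
by rewrite mulmxBl mul1mx mulmxBr mulmx1 PP subrr subr0.
Qed.

Lemma fsq_mulr_proj_le n (P : 'M[C]_d) (X : 'M[C]_(n, d)) :
  is_oproj P -> fsq (X *m P) <= fsq X.
Proof.
move=> PP; rewrite -fsq_adj adjmxM -[leRHS]fsq_adj.
by case: (PP) => -> _; exact: fsq_proj_le.
Qed.

Lemma fsq_pythagorasr n p (A B : 'M[C]_(n, p)) :
  A *m B^t* = 0 -> fsq (A + B) = fsq A + fsq B.
Proof.
move=> AB; rewrite -fsq_adj adjmxD fsq_pythagoras ?fsq_adj //.
by rewrite trmxCK.
Qed.

End CoordProj.

(** * Nested projectors on a dimension tree *)

Section Trees.
Variable d : nat.
Implicit Types t s : dtree d.

Lemma subtrees_refl t : t \in subtrees t.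
Proof. by case: t => [l|t1 t2]; rewrite inE eqxx. Qed.

Lemma subtrees_trans t s u :
  s \in subtrees t -> u \in subtrees s -> u \in subtrees t.
Proof.
elim: t => [l|t1 IH1 t2 IH2] /=.
  by rewrite inE => /eqP ->.
rewrite inE mem_cat => /orP[/eqP -> //|/orP[/IH1|/IH2] H /H us];
  by rewrite inE mem_cat us !orbT.
Qed.

Lemma subtrees_height t s : s \in subtrees t -> (height s <= height t)%N.
Proof.
elim: t => [l|t1 IH1 t2 IH2] /=; first by rewrite inE => /eqP ->.
rewrite inE mem_cat => /orP[/eqP -> //|/orP[/IH1|/IH2] /leq_trans -> //];
  by rewrite ltnW // ltnS ?leq_maxl ?leq_maxr.
Qed.

(** A child has smaller height than its parent, so it cannot be the whole tree. Thus rank bounds for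
    non-root subtrees apply to the children of every node, including the root. *)
Lemma subtrees_children t t1 t2 : DNode t1 t2 \in subtrees t ->
  [/\ t1 \in subtrees t, t2 \in subtrees t, t1 != t & t2 != t].
Proof.
move=> tt; have /= ht := subtrees_height tt; split.
- by apply: subtrees_trans tt _; rewrite inE mem_cat subtrees_refl orbT.
- by apply: subtrees_trans tt _; rewrite inE mem_cat subtrees_refl !orbT.
- apply: contraTneq ht => ->; rewrite -ltnNge ltnS leq_max ?leqnn //.
- apply: contraTneq ht => ->; rewrite -ltnNge ltnS leq_max ?leqnn ?orbT //.
Qed.

Lemma subtrees_leaf_set t s : s \in subtrees t -> leaf_set s \subset leaf_set t.
Proof.
elim: t => [l|t1 IH1 t2 IH2] /=; first by rewrite inE => /eqP ->.
rewrite inE mem_cat => /orP[/eqP -> //|/orP[/IH1|/IH2] /subset_trans -> //];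
  by rewrite ?subsetUl ?subsetUr.
Qed.

Lemma subtrees_ordered t s :
  ordered_leaves t -> s \in subtrees t -> ordered_leaves s.
Proof.
elim: t => [l|t1 IH1 t2 IH2] ot /=; first by rewrite inE => /eqP ->.
rewrite inE mem_cat; case/and3P: (ot) => o1 o2 _.
by move=> /orP[/eqP -> //|/orP[/(IH1 o1)|/(IH2 o2)]].
Qed.

Lemma ordered_lt t1 t2 : ordered_leaves (DNode t1 t2) ->
  {in leaf_set t1 & leaf_set t2, forall i j : 'I_d, (i < j)%N}.
Proof.
case/and3P=> _ _ /forall_inP lt i j it jt.
exact: (forall_inP (lt i it)).
Qed.

Lemma ordered_disjoint t1 t2 : ordered_leaves (DNode t1 t2) ->
  [disjoint leaf_set t1 & leaf_set t2].
Proof.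
move=> /ordered_lt lt; apply/pred0P => i /=; apply/negP => /andP[i1 i2].
by move: (lt i i i1 i2); rewrite ltnn.
Qed.

End Trees.

(** * The compressed matrix, its error and its ranks *)

Section TreeApprox.
Variables (C : numClosedFieldType) (d : nat).
Variables (beta : 'M[C]_d) (e : C).
Implicit Types t s : dtree d.
Hypothesis beta_upper : forall i j : 'I_d, (j <= i)%N -> beta i j = 0.
Hypothesis e_ge0 : 0 <= e.

Local Notation bs := (beta + beta^T).
Local Notation D t := (coord_proj C (leaf_set t)).

(** The outer block padded with zeros to size [d], so that all subtrees act on one space. *)
Definition outer t : 'M[C]_d := D t *m bs *m (1%:M - D t).

(** [top_proj] compares squared singular values, so [e] stands for eps^2. The outer block of a tree
    with all leaves is 0, and so is its projector unless the tree is a leaf. *)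
Fixpoint tree_proj t : 'M[C]_d :=
  match t with
  | DLeaf l => coord_proj C [set l]
  | DNode t1 t2 =>
      top_proj ((tree_proj t1 + tree_proj t2) *m outer (DNode t1 t2))
               (e * fsq (outer (DNode t1 t2)))
  end.
Local Notation P := tree_proj.

(** Projector onto the directions that the children kept and the node discards; a leaf discards
    nothing. *)
Definition tree_loss t : 'M[C]_d :=
  if t is DNode t1 t2 then P t1 + P t2 - P t else 0.

(** The right factor carries a transpose and no conjugation: beta_s is complex symmetric, so the
    columns of a block are compressed like the rows of its transpose. *)
Fixpoint tree_approx t : 'M[C]_d :=
  match t with
  | DLeaf _ => 0
  | DNode t1 t2 => tree_approx t1 + tree_approx t2 + P t1 *m beta *m (P t2)^T
  end.

Lemma threshold_ge0 t : 0 <= e * fsq (outer t).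
Proof. by rewrite mulr_ge0 ?fsq_ge0. Qed.

Lemma tree_projP t : ordered_leaves t -> is_oproj (P t) /\ D t *m P t = P t.
Proof.
elim: t => [l|t1 IH1 t2 IH2] ot.
  by split; [|case: (coord_proj_oproj C [set l])]; first exact: coord_proj_oproj.
case/and3P: (ot) => /IH1 [o1 s1] /IH2 [o2 s2] _; split.
  exact/top_proj_oproj/threshold_ge0.
rewrite /=; apply: top_proj_absorb; rewrite mulmxA; congr (_ *m _).
by rewrite mulmxDr -{1}s1 -{1}s2 !mulmxA !coord_proj_supset ?subsetUl ?subsetUr ?s1 ?s2.
Qed.

Lemma tree_proj_oproj t : ordered_leaves t -> is_oproj (P t).
Proof. by case/tree_projP. Qed.

Lemma tree_projl t : ordered_leaves t -> D t *m P t = P t.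
Proof. by case/tree_projP. Qed.

Lemma tree_projr t : ordered_leaves t -> P t *m D t = P t.
Proof.
move=> /tree_projP[[Ph _] DP].
by rewrite -[LHS]trmxCK adjmxM Ph (proj1 (coord_proj_oproj C _)) DP.
Qed.

Section Node.
Variables t1 t2 : dtree d.
Hypothesis ot : ordered_leaves (DNode t1 t2).
Local Notation t := (DNode t1 t2).

Let o1 : ordered_leaves t1. Proof. by case/and3P: ot. Qed.
Let o2 : ordered_leaves t2. Proof. by case/and3P: ot. Qed.

Lemma coord_proj12 : D t1 *m D t2 = 0.
Proof. exact/coord_proj_disjoint/ordered_disjoint. Qed.

Lemma coord_proj21 : D t2 *m D t1 = 0.
Proof. by apply/coord_proj_disjoint; rewrite disjoint_sym ordered_disjoint. Qed.

Lemma coord_proj_node : D t = D t1 + D t2.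
Proof. exact/coord_projU/ordered_disjoint. Qed.

Lemma tree_proj12 : P t1 *m P t2 = 0.
Proof.
rewrite -(tree_projr o1) -(tree_projl o2) -mulmxA (mulmxA (D t1)).
by rewrite coord_proj12 mul0mx mulmx0.
Qed.

Lemma tree_projD_oproj : is_oproj (P t1 + P t2).
Proof. by apply: is_oprojD tree_proj12; exact: tree_proj_oproj. Qed.

(** The matrix truncated at [t] was already compressed by the projectors of the children. This
    becomes the nestedness of the HSS bases. *)
Lemma tree_proj_nested : (P t1 + P t2) *m P t = P t.
Proof.
rewrite /=; apply: top_proj_absorb; rewrite mulmxA; congr (_ *m _).
by case: tree_projD_oproj.
Qed.

Lemma tree_proj_nestedr : P t *m (P t1 + P t2) = P t.
Proof.
have [[Ph _] [Qh _]] := (tree_proj_oproj ot, tree_projD_oproj).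
by rewrite -[LHS]trmxCK adjmxM Ph Qh tree_proj_nested.
Qed.

(** [D t - P t] is the sum of the tails of the two children and of [tree_loss t]; by nestedness
    these three have mutually orthogonal ranges. *)
Lemma fsq_node_tail n (X : 'M[C]_(d, n)) :
  fsq ((D t - P t) *m X) = fsq (tree_loss t *m X) +
    (fsq ((D t1 - P t1) *m X) + fsq ((D t2 - P t2) *m X)).
Proof.
have [[h1 p1] [h2 p2]] := (tree_proj_oproj o1, tree_proj_oproj o2).
have [l1 l2] := (tree_projl o1, tree_projl o2).
have [r1 r2] := (tree_projr o1, tree_projr o2).
have [k1 _] := coord_proj_oproj C (leaf_set t1).
have [k2 _] := coord_proj_oproj C (leaf_set t2).
have K1 : (D t1 - P t1) *m P t1 = 0 by rewrite mulmxBl l1 p1 subrr.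
have K2 : (D t2 - P t2) *m P t2 = 0 by rewrite mulmxBl l2 p2 subrr.
have K12 : (D t1 - P t1) *m D t2 = 0.
  by rewrite -r1 mulmxBl -mulmxA coord_proj12 mulmx0 subr0.
have K21 : (D t2 - P t2) *m D t1 = 0.
  by rewrite -r2 mulmxBl -mulmxA coord_proj21 mulmx0 subr0.
have L1 : (D t1 - P t1) *m (P t1 + P t2) = 0.
  by rewrite mulmxDr K1 -l2 mulmxA K12 mul0mx addr0.
have L2 : (D t2 - P t2) *m (P t1 + P t2) = 0.
  by rewrite mulmxDr K2 -l1 mulmxA K21 mul0mx addr0.
have M1 : (D t1 - P t1) *m tree_loss t = 0.
  rewrite /tree_loss mulmxBr -tree_proj_nested (mulmxA _ (P t1 + P t2)) L1.
  by rewrite mul0mx subrr.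
have M2 : (D t2 - P t2) *m tree_loss t = 0.
  rewrite /tree_loss mulmxBr -tree_proj_nested (mulmxA _ (P t1 + P t2)) L2.
  by rewrite mul0mx subrr.
have -> : D t - P t = (D t1 - P t1) + (D t2 - P t2) + tree_loss t.
  by rewrite coord_proj_node /tree_loss [X in _ = X + _]addrACA -opprD subrKA.
have H12 : ((D t1 - P t1) *m X)^t* *m ((D t2 - P t2) *m X) = 0.
  rewrite adjmxM adjmxB h1 k1 -mulmxA (mulmxA _ _ X) -{1}l2 (mulmxBr _ (D t2)).
  by rewrite (mulmxA _ (D t2) (P t2)) K12 mul0mx subrr mul0mx mulmx0.
have H3 : ((D t1 - P t1) *m X + (D t2 - P t2) *m X)^t* *m (tree_loss t *m X) = 0.
  rewrite adjmxD !adjmxM !adjmxB h1 k1 h2 k2 mulmxDl.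
  by rewrite -!mulmxA !(mulmxA _ _ X) M1 M2 !mulmx0 !mul0mx addr0.
rewrite (mulmxDl _ (tree_loss t)) (mulmxDl (D t1 - P t1)).
by rewrite (fsq_pythagoras H3) (fsq_pythagoras H12) addrC.
Qed.

End Node.

Lemma fsq_tail t n (X : 'M[C]_(d, n)) : ordered_leaves t ->
  fsq ((D t - P t) *m X) = \sum_(s <- subtrees t) fsq (tree_loss s *m X).
Proof.
elim: t => [l|t1 IH1 t2 IH2] ot.
  by rewrite big_seq1 /= subrr.
case/and3P: (ot) => o1 o2 _.
by rewrite big_cons big_cat /= -IH1 // -IH2 // fsq_node_tail.
Qed.

Lemma upper_block t1 t2 : ordered_leaves (DNode t1 t2) -> D t2 *m beta *m D t1 = 0.
Proof.
move=> ot; apply/matrixP => i j; rewrite coord_projrE coord_projlE [RHS]mxE.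
case: (boolP (i \in leaf_set t2)) => i2; last by rewrite mul0r mulr0.
case: (boolP (j \in leaf_set t1)) => j1; last by rewrite mul0r.
by rewrite beta_upper ?mulr0 // ltnW // (ordered_lt ot).
Qed.

Lemma tree_approx_supp t : ordered_leaves t ->
  D t *m tree_approx t = tree_approx t /\ tree_approx t *m D t = tree_approx t.
Proof.
elim: t => [l|t1 IH1 t2 IH2] ot; first by rewrite mulmx0 mul0mx.
case/and3P: (ot) => o1 o2 _.
have [[a1 b1] [a2 b2]] := (IH1 o1, IH2 o2).
rewrite /= !mulmxDr !mulmxDl; split; congr (_ + _ + _).
- by rewrite -a1 mulmxA coord_proj_supset ?subsetUl.
- by rewrite -a2 mulmxA coord_proj_supset ?subsetUr.
- by rewrite -(tree_projl o1) !mulmxA coord_proj_supset ?subsetUl.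
- by rewrite -b1 -mulmxA coord_proj_sub ?subsetUl.
- by rewrite -b2 -mulmxA coord_proj_sub ?subsetUr.
- rewrite -(tree_projl o2) trmx_mul coord_proj_tr.
  by rewrite -!mulmxA coord_proj_sub ?subsetUr.
Qed.

Lemma tree_approx_upper t : ordered_leaves t ->
  forall i j : 'I_d, (j <= i)%N -> tree_approx t i j = 0.
Proof.
elim: t => [l|t1 IH1 t2 IH2] ot i j ji /=; first by rewrite mxE.
case/and3P: (ot) => o1 o2 _.
rewrite mxE [X in X + _]mxE IH1 // IH2 // !add0r.
rewrite -(tree_projl o1) -(tree_projl o2) trmx_mul coord_proj_tr !mulmxA.
rewrite coord_projrE -!mulmxA coord_projlE.
case: (boolP (i \in leaf_set t1)) => i1; last by rewrite mul0r mulr0.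
case: (boolP (j \in leaf_set t2)) => j2; last by rewrite mul0r.
by have := ordered_lt ot i1 j2; rewrite ltnNge ji.
Qed.

(** Every other node contributes only to rows or columns disjoint from this block. *)
Lemma tree_approx_block t t1 t2 : ordered_leaves t ->
  DNode t1 t2 \in subtrees t ->
  D t1 *m tree_approx t *m D t2 = P t1 *m beta *m (P t2)^T.
Proof.
have Ptr u : ordered_leaves u -> (P u)^T *m D u = (P u)^T.
  by move=> ou; rewrite -coord_proj_tr -trmx_mul tree_projl.
elim: t => [l|u1 IH1 u2 IH2] ot; first by rewrite inE.
case/and3P: (ot) => o1 o2 _.
have [[a1 b1] [a2 b2]] := (tree_approx_supp o1, tree_approx_supp o2).
rewrite /= inE mem_cat; case: eqP => [[-> ->] _|_ /=].
  rewrite !mulmxDr !mulmxDl -{1}b1 -{1}a2 -!mulmxA (mulmxA (D u1) (D u2)).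
  rewrite (coord_proj12 ot) !mul0mx !mulmx0 !add0r.
  by rewrite Ptr // mulmxA tree_projl.
case/orP => ts.
  have [s1 s2 _ _] := subtrees_children ts.
  have {}s1 := disjointWl (subtrees_leaf_set s1) (ordered_disjoint ot).
  have {}s2 := disjointWl (subtrees_leaf_set s2) (ordered_disjoint ot).
  rewrite !mulmxDr !mulmxDl IH1 // -{1}a2 mulmxA coord_proj_disjoint // !mul0mx.
  rewrite -!mulmxA -(Ptr u2) // -(mulmxA _ (D u2)).
  rewrite (@coord_proj_disjoint _ _ (leaf_set u2)) //.
    by rewrite !mulmx0 !addr0.
  by rewrite disjoint_sym.
have [s1 s2 _ _] := subtrees_children ts.
have {}s1 := disjointWr (subtrees_leaf_set s1) (ordered_disjoint ot).
have {}s2 := disjointWr (subtrees_leaf_set s2) (ordered_disjoint ot).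
rewrite !mulmxDr !mulmxDl IH2 // -{1}b1 -!mulmxA coord_proj_disjoint // !mulmx0.
rewrite -(tree_projl o1) -!mulmxA (mulmxA (D t1)).
rewrite (@coord_proj_disjoint _ _ (leaf_set t1)) //.
  by rewrite !mul0mx addr0 add0r.
by rewrite disjoint_sym.
Qed.

(** The errors inside [t1], inside [t2] and in the coupling block occupy disjoint entries. The
    coupling error is charged to the losses below [t1] acting on the columns of [t2], and
    symmetrically; this widens the column range of each loss from its child to [t]. *)
Lemma fsq_tree_err t : ordered_leaves t ->
  fsq (D t *m beta *m D t - tree_approx t)
    <= \sum_(s <- subtrees t) fsq (tree_loss s *m bs *m (D t - D s)).
Proof.
elim: t => [l|t1 IH1 t2 IH2] ot.
  rewrite big_seq1 /= subrr mulmx0 subr0.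
  suff -> : coord_proj C [set l] *m beta *m coord_proj C [set l] = 0 by [].
  apply/matrixP => i j; rewrite coord_projrE coord_projlE !inE [RHS]mxE.
  case: eqP => [->|]; last by rewrite mul0r.
  case: eqP => [->|]; last by rewrite mul0r mulr0.
  by rewrite beta_upper ?mulr0.
case/and3P: (ot) => o1 o2 _.
have [[a1 b1] [a2 b2]] := (tree_approx_supp o1, tree_approx_supp o2).
have [[h1 p1] [h2 p2]] := (tree_proj_oproj o1, tree_proj_oproj o2).
have [k1 m1] := coord_proj_oproj C (leaf_set t1).
have [k2 m2] := coord_proj_oproj C (leaf_set t2).
have [c12 c21] := (coord_proj12 ot, coord_proj21 ot).
set E1 := D t1 *m beta *m D t1 - tree_approx t1 in IH1.
set E2 := D t2 *m beta *m D t2 - tree_approx t2 in IH2.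
pose G := D t1 *m beta *m D t2 - P t1 *m beta *m (P t2)^T.
have -> : D (DNode t1 t2) *m beta *m D (DNode t1 t2) - tree_approx (DNode t1 t2)
   = E1 + G + E2.
  rewrite (coord_proj_node ot) !mulmxDl !mulmxDr (upper_block ot) add0r /=.
  rewrite /E1 /E2 /G; apply/matrixP => i j; rewrite !mxE; ring.
have E1r : E1 *m D t1 = E1 by rewrite /E1 mulmxBl b1 -(mulmxA _ (D t1)) m1.
have E1l : D t1 *m E1 = E1 by rewrite /E1 mulmxBr a1 !mulmxA m1.
have E2l : D t2 *m E2 = E2 by rewrite /E2 mulmxBr a2 !mulmxA m2.
have Gr : G *m D t2 = G.
  rewrite /G mulmxBl -!mulmxA m2; congr (_ - _ *m (_ *m _)).
  by rewrite -coord_proj_tr -trmx_mul tree_projl.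
have Gl : D t1 *m G = G by rewrite /G mulmxBr !mulmxA m1 tree_projl.
(* [E2] has rows in [t2], the other two in [t1]; [E1] and [G] then differ in their columns. *)
rewrite fsq_pythagoras; last first.
  rewrite adjmxD -E1l -Gl -E2l !adjmxM k1 mulmxDl -!mulmxA !(mulmxA (D t1)) c12.
  by rewrite !mul0mx !mulmx0 addr0.
rewrite fsq_pythagorasr; last first.
  by rewrite -E1r -Gr adjmxM k2 -!mulmxA (mulmxA (D t1)) c12 mul0mx mulmx0.
(* The summand of the node itself is bounded below by 0 and dropped. *)
rewrite big_cons big_cat /= -[X in X <= _]add0r; apply: lerD; first exact: fsq_ge0.
have bs12 : D t1 *m bs *m D t2 = D t1 *m beta *m D t2.
  rewrite mulmxDr mulmxDl; suff -> : D t1 *m beta^T *m D t2 = 0 by rewrite addr0.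
  apply: trmx_inj.
  by rewrite !trmx_mul trmxK !coord_proj_tr mulmxA (upper_block ot) trmx0.
have bs21 : D t2 *m bs *m D t1 = (D t1 *m beta *m D t2)^T.
  apply: trmx_inj; rewrite trmxK -bs12 !trmx_mul !coord_proj_tr mulmxA.
  by rewrite linearD /= trmxK [beta^T + _]addrC.
have GE : fsq G <= \sum_(s <- subtrees t1) fsq (tree_loss s *m bs *m D t2)
     + \sum_(s <- subtrees t2) fsq (tree_loss s *m bs *m D t1).
  (* First the rows are compressed, then the columns of what remains; the two errors have orthogonal
     ranges. *)
  have -> : G = (D t1 - P t1) *m beta *m D t2 +
      P t1 *m (D t1 *m beta *m (D t2 - (P t2)^T)).
    rewrite !mulmxA tree_projr //.
    by rewrite !mulmxBl !mulmxBr /G addrA subrK.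
  rewrite fsq_pythagoras; last first.
    rewrite !adjmxM adjmxB k1 h1 -!mulmxA (mulmxA (D t1 - P t1) (P t1)).
    by rewrite mulmxBl tree_projl // p1 subrr mul0mx !mulmx0.
  apply: lerD.
    under eq_bigr do rewrite -mulmxA.
    rewrite -fsq_tail // -[D t1 - P t1](_ : (D t1 - P t1) *m D t1 = _); last first.
      by rewrite mulmxBl m1 tree_projr.
    by rewrite -!mulmxA !(mulmxA (D t1)) bs12.
  (* After removing the contraction [P t1], the column error is the row error of the transposed
     block, which [bs] contains below the diagonal. *)
  apply: le_trans (fsq_proj_le _ (tree_proj_oproj o1)) _.
  under eq_bigr do rewrite -mulmxA.
  rewrite -fsq_tail // -[D t2 - P t2](_ : (D t2 - P t2) *m D t2 = _); last first.
    by rewrite mulmxBl m2 tree_projr.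
  rewrite -!mulmxA !(mulmxA (D t2)) bs21 -fsq_tr !trmx_mul.
  rewrite linearB /= coord_proj_tr trmxK.
  by rewrite !mulmxA [(_ - _) *m D t2]mulmxBl m2 tree_projr.
(* For [s] below [t1], the leaves of the node outside [s] are those of [t1] outside [s] together
   with those of [t2]. *)
have S1 : \sum_(s <- subtrees t1) fsq (tree_loss s *m bs *m (D (DNode t1 t2) - D s))
   = \sum_(s <- subtrees t1) fsq (tree_loss s *m bs *m (D t1 - D s)) +
     \sum_(s <- subtrees t1) fsq (tree_loss s *m bs *m D t2).
  rewrite -big_split; apply: eq_big_seq => s /subtrees_leaf_set st /=.
  rewrite -fsq_pythagorasr -?mulmxDr ?(coord_proj_node ot) 1?addrAC //.
  rewrite adjmxM k2 -!mulmxA (mulmxA (_ - _)) mulmxBl c12.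
  rewrite coord_proj_disjoint ?subrr ?mul0mx ?mulmx0 //.
  exact: disjointWl st (ordered_disjoint ot).
have S2 : \sum_(s <- subtrees t2) fsq (tree_loss s *m bs *m (D (DNode t1 t2) - D s))
   = \sum_(s <- subtrees t2) fsq (tree_loss s *m bs *m (D t2 - D s)) +
     \sum_(s <- subtrees t2) fsq (tree_loss s *m bs *m D t1).
  rewrite -big_split; apply: eq_big_seq => s /subtrees_leaf_set st /=.
  rewrite -fsq_pythagorasr -?mulmxDr ?(coord_proj_node ot) 1?addrAC //.
    by congr (fsq (_ *m _)); rewrite addrAC [in RHS]addrAC [D t2 + _]addrC.
  rewrite adjmxM k1 -!mulmxA (mulmxA (_ - _)) mulmxBl c21.
  rewrite coord_proj_disjoint ?subrr ?mul0mx ?mulmx0 //.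
  by apply: disjointWl st _; rewrite disjoint_sym (ordered_disjoint ot).
rewrite S1 S2 addrACA addrAC; apply: lerD; last exact: (IH2 o2).
by apply: lerD GE; exact: (IH1 o1).
Qed.

(** The node pays once for all its rows; its children partition these rows and have at least one
    level less. *)
Lemma fsq_subtrees t n (X : 'M[C]_(d, n)) : ordered_leaves t ->
  \sum_(s <- subtrees t) fsq (D s *m X) <= fsq (D t *m X) *+ (height t).+1.
Proof.
elim: t => [l|t1 IH1 t2 IH2] ot; first by rewrite big_seq1.
case/and3P: (ot) => o1 o2 _.
rewrite big_cons big_cat /= mulrS lerD2l.
have -> : fsq (coord_proj C (leaf_set t1 :|: leaf_set t2) *m X)
    = fsq (D t1 *m X) + fsq (D t2 *m X).
  rewrite (coord_proj_node ot) mulmxDl fsq_pythagoras //.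
  rewrite adjmxM (proj1 (coord_proj_oproj C _)) -mulmxA (mulmxA (D t1)).
  by rewrite (coord_proj12 ot) mul0mx mulmx0.
rewrite mulrnDl; apply: lerD.
  by apply: le_trans (IH1 o1) _; rewrite ler_wpMn2l ?fsq_ge0 // ltnS leq_maxl.
by apply: le_trans (IH2 o2) _; rewrite ler_wpMn2l ?fsq_ge0 // ltnS leq_maxr.
Qed.

Section Rank.
Variables (tbar : dtree d) (k : nat).
Hypothesis obar : ordered_leaves tbar.
Hypothesis k_gt0 : (0 < k)%N.
Hypothesis outer_low_rank : forall t, t \in subtrees tbar -> ~~ is_leaf t ->
  t != tbar -> exists p (X : 'M[C]_(p, d)), (\rank X <= k)%N /\
    forall v : 'cV[C]_d, X *m v = 0 ->
      fsq (outer t *m v) <= e * fsq (outer t) * fsq v.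

(** Compression by the children's projectors does not increase the norm of [outer t *m v], so the
    annihilator of [outer t] also serves the compressed matrix. A leaf has rank 1. *)
Lemma rank_tree_proj t :
  t \in subtrees tbar -> t != tbar -> (\rank (P t) <= k)%N.
Proof.
case: t => [l|t1 t2] ts tn /=.
  by apply: leq_trans (rank_diag_le (J := [set l]) _) _; rewrite ?cards1 // => j /negPf;
     rewrite !mxE => ->.
have ot := subtrees_ordered obar ts.
apply: leq_trans (rank_top_proj _ _) _.
have [//|p [X [rX HX]]] := outer_low_rank ts _ tn.
apply: leq_trans rX; apply: card_eig_gt (threshold_ge0 _) _ => v /HX.
rewrite -mulmxA; apply: le_trans; apply: fsq_proj_le.
exact: (tree_projD_oproj ot).
Qed.

(** This is the truncation error of a matrix of rank at most 2k, as each of the two children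
    contributes a projector of rank at most [k]. *)
Lemma fsq_tree_loss t : t \in subtrees tbar ->
  fsq (tree_loss t *m outer t) <= e * fsq (outer t) *+ (k + k).
Proof.
case: t => [l|t1 t2] ts; first by rewrite mul0mx fsq0 mulrn_wge0 ?threshold_ge0.
have ot := subtrees_ordered obar ts.
have [s1 s2 n1 n2] := subtrees_children ts.
set t := DNode t1 t2; set Pi := P t1 + P t2.
have -> : tree_loss t *m outer t = Pi *m outer t - P t *m (Pi *m outer t).
  rewrite -[tree_loss t]/(Pi - P t) (mulmxBl Pi) (mulmxA (P t) Pi).
  by rewrite (tree_proj_nestedr ot).
apply: le_trans (fsq_top_proj (Pi *m outer t) (threshold_ge0 t)) _.
rewrite ler_wpMn2l ?threshold_ge0 //; apply: leq_trans (mxrankM_maxl _ _) _.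
by apply: leq_trans (mxrank_add _ _) _; rewrite leq_add ?rank_tree_proj.
Qed.

Hypothesis full : leaf_set tbar = setT.

Lemma fsq_approx_err :
  fsq (beta - tree_approx tbar) <= e * fsq bs *+ (height tbar).+1 *+ (k + k).
Proof.
have := fsq_tree_err obar; rewrite full coord_projT mul1mx mulmx1 => /le_trans; apply.
apply: (@le_trans _ _ (\sum_(s <- subtrees tbar) e * fsq (outer s) *+ (k + k))).
  rewrite big_seq [leRHS]big_seq; apply: ler_sum => s ss.
  apply: le_trans (fsq_tree_loss ss); rewrite le_eqVlt; apply/orP; left; apply/eqP.
  (* The loss at [s] is supported on the leaves of [s], so it absorbs the row projector in
     [outer s]. *)
  congr fsq; rewrite /outer !mulmxA; congr (_ *m _ *m _).
  have os := subtrees_ordered obar ss.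
  case: s ss os => [l|t1 t2] ss os; first by rewrite mul0mx.
  case/and3P: (os) => o1 o2 _.
  have q1 : P t1 *m D (DNode t1 t2) = P t1.
    by rewrite -{1}(tree_projr o1) -mulmxA coord_proj_sub ?subsetUl // tree_projr.
  have q2 : P t2 *m D (DNode t1 t2) = P t2.
    by rewrite -{1}(tree_projr o2) -mulmxA coord_proj_sub ?subsetUr // tree_projr.
  by rewrite mulmxBl (tree_projr os) mulmxDl q1 q2.
rewrite sumrMnl -mulr_sumr -mulrnAr.
rewrite lerMn2r; apply/orP; right; apply: ler_wpM2l => //.
apply: le_trans (_ : \sum_(s <- subtrees tbar) fsq (D s *m bs) <= _); last first.
  by apply: le_trans (fsq_subtrees _ obar) _; rewrite full coord_projT mul1mx.
apply: ler_sum => s _; apply: fsq_mulr_proj_le.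
exact/is_oprojC/coord_proj_oproj.
Qed.

End Rank.
End TreeApprox.

(** * HSS decompositions and tree tensor networks from nested bases *)

Section Factor.
Variables (F : fieldType) (d k : nat).
Implicit Types P : 'M[F]_d.

(** The inner dimension is exactly [k], with zero padding below that rank. The leading [P] keeps the
    columns in the range of [P] and is harmless when [P] is idempotent. *)
Definition factl P : 'M[F]_(d, k) := P *m (col_ebase P *m pid_mx (\rank P)).
Definition factr P : 'M[F]_(k, d) := pid_mx (\rank P) *m row_ebase P.

Lemma factlrK P : P *m P = P -> (\rank P <= k)%N -> factl P *m factr P = P.
Proof.
move=> PP rP; rewrite /factl /factr -!mulmxA (mulmxA (pid_mx _)) mul_pid_mx.
rewrite minnn (minn_idPr rP) (mulmxA (col_ebase P)) mulmx_ebase.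
exact: PP.
Qed.

Lemma mul_factl Q P : Q *m P = P -> Q *m factl P = factl P.
Proof. by move=> QP; rewrite /factl mulmxA QP. Qed.

End Factor.

Section Leaves.
Variable d : nat.

Lemma leaf_at_in (t : dtree d) (i : 'I_(nleaves t)) : leaf_at i \in leaf_set t.
Proof.
elim: t i => [l|t1 IH1 t2 IH2] i /=; first by rewrite inE.
by case: (split i) => j; rewrite inE ?IH1 ?IH2 ?orbT.
Qed.

Lemma big_setU_disjoint (R : Type) (idx : R) (op : Monoid.com_law idx)
    (I : finType) (A B : {set I}) (F : I -> R) : [disjoint A & B] ->
  \big[op/idx]_(i in A :|: B) F i =
    op (\big[op/idx]_(i in A) F i) (\big[op/idx]_(i in B) F i).
Proof.
by move=> AB; rewrite -bigU //; apply: eq_bigl => i; rewrite !inE.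
Qed.

Lemma sum_leaf_at (V : nmodType) (t : dtree d) (F : 'I_d -> V) :
  ordered_leaves t -> \sum_(i < nleaves t) F (leaf_at i) = \sum_(i in leaf_set t) F i.
Proof.
elim: t => [l|t1 IH1 t2 IH2] ot; first by rewrite big_ord1 big_set1.
case/and3P: (ot) => o1 o2 _.
rewrite big_split_ord big_setU_disjoint ?ordered_disjoint // -IH1 // -IH2 //.
congr (_ + _); apply: eq_bigr => i _ /=.
  by rewrite (unsplitK (inl _ i)).
by rewrite (unsplitK (inr _ i)).
Qed.

End Leaves.

(** * HSS decomposition from nested bases *)

Section HSSOfNested.
Variables (R : realType) (d k : nat).
Local Notation C := R[i].
Variables (tbar : dtree d) (B : 'M[C]_d).
Variables (V : dtree d -> 'M[C]_(d, k)) (S T1 T2 : dtree d -> dtree d -> 'M[C]_k).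
Hypothesis obar : ordered_leaves tbar.
Hypothesis bar_node : ~~ is_leaf tbar.
Hypothesis V_supp : forall t, t \in subtrees tbar -> t != tbar ->
  coord_proj C (leaf_set t) *m V t = V t.
Hypothesis V_nested : forall t1 t2, DNode t1 t2 \in subtrees tbar ->
  DNode t1 t2 != tbar ->
  V (DNode t1 t2) = V t1 *m T1 t1 t2 + V t2 *m T2 t1 t2.
Hypothesis B_block : forall t1 t2, DNode t1 t2 \in subtrees tbar ->
  coord_proj C (leaf_set t1) *m B *m coord_proj C (leaf_set t2)
    = V t1 *m S t1 t2 *m (V t2)^T.

Lemma has_hss_nested : has_hss tbar B k.
Proof.
exists (fun=> k), (fun t => rowsub (@leaf_at d t) (V t)); split.
- move=> t1 t2 ts; exists (S t1 t2).
  apply/matrixP => i j.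
  transitivity ((V t1 *m S t1 t2 *m (V t2)^T) (leaf_at i) (leaf_at j)).
    by rewrite -B_block // coord_projrE coord_projlE !leaf_at_in !mul1r mxE.
  rewrite mxE [RHS]mxE; apply: eq_bigr => q _; rewrite !mxE; congr (_ * _).
  by apply: eq_bigr => p _; rewrite mxE.
- move=> t1 t2 ts tn; exists (col_mx (T1 t1 t2) (T2 t1 t2)).
  have [s1 s2 n1 n2] := subtrees_children ts.
  have ot := subtrees_ordered obar ts.
  rewrite mul_block_col !mul0mx addr0 add0r V_nested // !mul_rowsub_mx.
  apply/matrixP => i q; rewrite !mxE /=.
  (* On rows of one child, the basis of the other child vanishes by its support. *)
  case: splitP => j _; rewrite !mxE.
    rewrite [X in _ + X]big1 ?addr0 // => p _.
    rewrite -(V_supp s2) // coord_projlE.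
  rewrite (disjointFr (ordered_disjoint ot)) ?leaf_at_in //.
    by rewrite !mul0r.
  rewrite [X in X + _]big1 ?add0r // => p _.
  rewrite -(V_supp s1) // coord_projlE.
  rewrite (disjointFl (ordered_disjoint ot)) ?leaf_at_in //.
  by rewrite !mul0r.
(* All ranks equal [k], and the first child of the root attains the maximum. *)
- apply/eqP; rewrite eqn_leq; apply/andP; split.
    by apply/bigmax_leqP_seq.
  case: tbar bar_node => // t1 t2 _.
  have [s1 _ n1 _] := subtrees_children (subtrees_refl (DNode t1 t2)).
  exact: (@leq_bigmax_seq _ _ (fun t => t != DNode t1 t2) (fun=> k) t1).
Qed.

End HSSOfNested.

(** * Tree ordering of multi-indices *)

Section TreeIndex.
Variables (d : nat) (N : 'I_d -> nat).

Fixpoint tree_index (m : forall i, 'I_(N i)) t : 'I_(tree_dim N t) :=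
  match t with
  | DLeaf l => m l
  | DNode t1 t2 => mxtens_index (tree_index m t2, tree_index m t1)
  end.

Lemma tree_dimE t : ordered_leaves t ->
  tree_dim N t = (\prod_(i in leaf_set t) N i)%N.
Proof.
elim: t => [l|t1 IH1 t2 IH2] ot /=; first by rewrite big_set1.
case/and3P: (ot) => o1 o2 _.
by rewrite IH1 // IH2 // big_setU_disjoint ?ordered_disjoint // mulnC.
Qed.

(** All leaves of the first child precede those of the second, so each weight in the second gains
    the full dimension of the first. For the full leaf set this is the formula of [vec_indexE]. *)
Lemma tree_indexE m t : ordered_leaves t ->
  tree_index m t = (\sum_(i in leaf_set t) m i *
    \prod_(j in leaf_set t | j < i) N j)%N :> nat.
Proof.
elim: t => [l|t1 IH1 t2 IH2] ot /=.
  rewrite big_set1 big1 ?muln1 // => j; rewrite inE => /andP[/eqP ->].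
  by rewrite ltnn.
case/and3P: (ot) => o1 o2 _; have lt := ordered_lt ot.
rewrite IH1 // IH2 // big_setU_disjoint ?ordered_disjoint // addnC; congr (_ + _)%N.
  apply: eq_bigr => i i1; congr (_ * _)%N; apply: eq_bigl => j.
  rewrite inE; case: (boolP (j \in leaf_set t1)) => //= j1.
  case: (boolP (j \in leaf_set t2)) => //= j2.
  by apply/esym/negbTE; rewrite -leqNgt ltnW // lt.
rewrite tree_dimE // big_distrl; apply: eq_bigr => i i2 /=.
rewrite -mulnA; congr (_ * _)%N; rewrite mulnC.
rewrite [RHS](bigID (fun j => j \in leaf_set t1)) /=; congr (_ * _)%N.
  apply: eq_bigl => j; rewrite inE.
  by case: (boolP (j \in leaf_set t1)) => j1; rewrite ?andbF //= lt.
apply: eq_bigl => j; rewrite inE.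
case: (boolP (j \in leaf_set t1)) => j1; rewrite ?andbF ?andbT //=.
by rewrite (disjointFr (ordered_disjoint ot) j1).
Qed.

Lemma tree_index_vec m t : ordered_leaves t -> leaf_set t = setT ->
  tree_index m t = vec_index m :> nat.
Proof.
move=> ot full; rewrite tree_indexE // vec_indexE full.
apply: eq_big => [i|i _]; rewrite ?inE //; congr (_ * _)%N.
by apply: eq_bigl => j; rewrite inE.
Qed.

End TreeIndex.

Section NatIndexing.
Variable K : comNzRingType.

(* Matrix entries at natural number indices, 0 outside the matrix. *)
Definition nentry m n (M : 'M[K]_(m, n)) (p q : nat) : K :=
  if (insub p : option 'I_m, insub q : option 'I_n) is (Some i, Some j)
  then M i j else 0.

Lemma nentryE m n (M : 'M[K]_(m, n)) (i : 'I_m) (j : 'I_n) : nentry M i j = M i j.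
Proof. by rewrite /nentry !valK. Qed.

Lemma nentryD m n (M M' : 'M[K]_(m, n)) p q :
  nentry (M + M') p q = nentry M p q + nentry M' p q.
Proof.
by rewrite /nentry; do 2 (case: insub => [?|]; rewrite ?addr0 //); rewrite mxE.
Qed.

Lemma nentryM m n p (M : 'M[K]_(m, n)) (M' : 'M[K]_(n, p)) i j :
  nentry (M *m M') i j = \sum_(q < n) nentry M i q * nentry M' q j.
Proof.
rewrite {1}/nentry; case Ei: (insub i : option 'I_m) => [i'|]; last first.
  by rewrite big1 // => q _; rewrite /nentry Ei mul0r.
case Ej: (insub j : option 'I_p) => [j'|]; last first.
  by rewrite big1 // => q _; rewrite {2}/nentry valK Ej mulr0.
by rewrite mxE; apply: eq_bigr => q _; rewrite /nentry Ei Ej !valK.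
Qed.

(** The size is given by an equation because [op_rank] depends on a test against the root. *)
Lemma sum_ord_SS (r k : nat) (F : nat -> K) : r = k.+2 ->
  \sum_(q < r) F q = F 0 + F 1 + \sum_(p < k) F p.+2.
Proof. by move=> ->; rewrite !big_ord_recl addrA. Qed.

Lemma tensmx_sumE m n p q (U : 'M[K]_(m, n)) (V : 'M[K]_(p, q)) r
    (T : 'M[K]_(n * q, r)) i j c :
  ((U *t V) *m T) (mxtens_index (i, j)) c =
  \sum_a \sum_b U i a * V j b * T (mxtens_index (a, b)) c.
Proof.
rewrite mxE pair_bigA /= (reindex (@mxtens_index n q)) /=; last first.
  by exists (@mxtens_unindex n q) => ? _; rewrite ?mxtens_indexK ?mxtens_unindexK.
by apply: eq_bigr => -[a b] _; rewrite tensmxE.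
Qed.

Lemma kronM d (n : 'I_d -> nat) (B B' : forall i, 'M[K]_(n i)) :
  kron B *m kron B' = kron (fun i => B i *m B' i).
Proof.
elim: d n B B' => [|d IH] n B B' /=; first by rewrite mul1mx.
by rewrite tensmx_mul IH.
Qed.

End NatIndexing.

(** * Tensor network of the pair operator *)

Section TTNOfNested.
Variables (R : realType) (d k : nat).
Local Notation C := R[i].
Variables (tbar : dtree d).
Variables (V : dtree d -> 'M[C]_(d, k)) (S T1 T2 : dtree d -> dtree d -> 'M[C]_k).
Hypothesis obar : ordered_leaves tbar.
Hypothesis full : leaf_set tbar = setT.
Hypothesis bar_node : ~~ is_leaf tbar.
Hypothesis V_supp : forall t, t \in subtrees tbar -> t != tbar ->
  coord_proj C (leaf_set t) *m V t = V t.
Hypothesis V_nested : forall t1 t2, DNode t1 t2 \in subtrees tbar ->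
  DNode t1 t2 != tbar ->
  V (DNode t1 t2) = V t1 *m T1 t1 t2 + V t2 *m T2 t1 t2.

Fixpoint nested_mx (t : dtree d) : 'M[C]_d :=
  match t with
  | DLeaf _ => 0
  | DNode t1 t2 => nested_mx t1 + nested_mx t2 + V t1 *m S t1 t2 *m (V t2)^T
  end.

Variables (n : 'I_d -> nat) (A : forall i, 'M[C]_(n i)).
Local Notation N := (fun i => n i * n i)%N.

Definition op_rank (t : dtree d) : nat := if t == tbar then 1%N else k.+2.

(* Column 0 carries the identity, column 1 the interactions inside the subtree,
   and column [p + 2] the combination of the one-site operators with the weights
   in column [p] of [V]; the root keeps only the interactions. *)
Definition col_role (t : dtree d) (c : nat) : nat := if t == tbar then 1%N else c.

(** An interaction is inherited from one child or created by [S] from a weighted one-site operator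
    in each. A weighted one-site operator comes from one child through [T1] or [T2], with the
    identity on the other. *)
Definition role_transfer (S T1 T2 : nat -> nat -> C) (c1 c2 c : nat) : C :=
  match c, c1, c2 with
  | 0, 0, 0 => 1
  | 1, 1, 0 => 1
  | 1, 0, 1 => 1
  | 1, p.+2, q.+2 => S p q
  | q.+2, p.+2, 0 => T1 p q
  | q.+2, 0, p.+2 => T2 p q
  | _, _, _ => 0
  end.

Lemma sum_role_transfer (v1 v2 : nat -> C) (r1 r2 : nat)
    (s u1 u2 : nat -> nat -> C) c :
  r1 = k.+2 -> r2 = k.+2 ->
  \sum_(a < r2) \sum_(b < r1) v2 a * v1 b * role_transfer s u1 u2 b a c =
  match c with
  | 0 => v1 0 * v2 0
  | 1 => v1 1 * v2 0 + v1 0 * v2 1 +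
         \sum_(p < k) \sum_(q < k) v1 p.+2 * s p q * v2 q.+2
  | q.+2 => \sum_(p < k) v1 p.+2 * u1 p q * v2 0 +
            \sum_(p < k) v1 0 * u2 p q * v2 p.+2
  end.
Proof.
move=> e1 e2; pose F a b := v2 a * v1 b * role_transfer s u1 u2 b a c.
under eq_bigr => a _ do rewrite (sum_ord_SS (F a) e1).
rewrite (sum_ord_SS (fun a => F a 0 + F a 1 + \sum_(p < k) F a p.+2) e2) /F.
have z (f : nat -> C) : \sum_(p < k) f p * 0 = 0 by apply: big1 => p _; rewrite mulr0.
case: c {F} => [|[|q]] /=.
- rewrite (z (fun p => v2 0 * v1 p.+2)) (z (fun p => v2 1 * v1 p.+2)).
  rewrite [X in _ + X]big1 => [|p _]; first ring.
  by rewrite (z (fun p0 => v2 p.+2 * v1 p0.+2)) !mulr0 !addr0.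
- rewrite (z (fun p => v2 0 * v1 p.+2)) (z (fun p => v2 1 * v1 p.+2)).
  rewrite exchange_big /= !mulr0 !mulr1 !addr0 add0r [v2 0 * _]mulrC [v2 1 * _]mulrC.
  congr (_ + _); apply: eq_bigr => q _; rewrite !mulr0 !add0r.
  by apply: eq_bigr => p _; ring.
- rewrite (z (fun p => v2 1 * v1 p.+2)) !mulr0 !addr0 !add0r.
  congr (_ + _); apply: eq_bigr => p _; first ring.
  by rewrite (z (fun p0 => v2 p.+2 * v1 p0.+2)) mulr0 !addr0; ring.
Qed.

(** Column 1 is zero because a single site carries no pair interaction. *)
Definition leaf_value (l : 'I_d) (x : 'I_(N l)) (c : nat) : C :=
  match c with
  | 0 => vec_mx_col (1%:M : 'M[C]_(n l)) x 0
  | 1 => 0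
  | q.+2 => nentry (V (DLeaf l)) l q * vec_mx_col (A l) x 0
  end.

Definition op_ttn : ttn R N :=
  @TTN R d N op_rank
    (fun l => \matrix_(x, c) leaf_value x (col_role (DLeaf l) c))
    (fun t1 t2 c1 c2 c => role_transfer (nentry (S t1 t2)) (nentry (T1 t1 t2))
       (nentry (T2 t1 t2)) c1 c2 (col_role (DNode t1 t2) c)).

Section Value.
Variable m : forall i, 'I_(N i).

Definition site_prod (Q : pred 'I_d) (t : dtree d) : C :=
  \prod_(l in leaf_set t)
    vec_mx_col (if Q l then A l else 1%:M : 'M[C]_(n l)) (m l) 0.

(** Closed form of the network entries, proved to satisfy the same recursion as [ttn_mx]. *)
Definition tree_value (t : dtree d) (c : nat) : C :=
  match c with
  | 0 => site_prod pred0 t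
  | 1 => \sum_i \sum_j nested_mx t i j * site_prod (pred2 i j) t
  | q.+2 => \sum_(i < d) nentry (V t) i q * site_prod (pred1 i) t
  end.

Lemma eq_site_prod (Q Q' : pred 'I_d) t :
  {in leaf_set t, Q =1 Q'} -> site_prod Q t = site_prod Q' t.
Proof. by move=> QQ; apply: eq_bigr => l lt; rewrite QQ. Qed.

Lemma site_prod_node Q t1 t2 : ordered_leaves (DNode t1 t2) ->
  site_prod Q (DNode t1 t2) = site_prod Q t1 * site_prod Q t2.
Proof. by move=> ot; rewrite /site_prod big_setU_disjoint ?ordered_disjoint. Qed.

Lemma nentry_supp t i q : t \in subtrees tbar -> t != tbar ->
  i \notin leaf_set t -> nentry (V t) i q = 0.
Proof.
move=> ts tn it; rewrite /nentry valK; case: insub => // q'.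
by rewrite -V_supp // coord_projlE (negPf it) mul0r.
Qed.

Lemma nested_mx_supp t i j : t \in subtrees tbar ->
  (i \notin leaf_set t) || (j \notin leaf_set t) -> nested_mx t i j = 0.
Proof.
elim: t => [l|t1 IH1 t2 IH2] ts ij /=; first by rewrite mxE.
have [s1 s2 n1 n2] := subtrees_children ts.
have ij1 : (i \notin leaf_set t1) || (j \notin leaf_set t1).
  by case/orP: ij => h; apply/orP; [left|right]; apply: contra h => h;
     rewrite inE h.
have ij2 : (i \notin leaf_set t2) || (j \notin leaf_set t2).
  by case/orP: ij => h; apply/orP; [left|right]; apply: contra h => h;
     rewrite inE h orbT.
rewrite mxE [X in X + _]mxE IH1 ?IH2 ?add0r //.
rewrite -(V_supp s1) // -(V_supp s2) // trmx_mul coord_proj_tr mulmxA.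
rewrite coord_projrE -!mulmxA coord_projlE.
case: (boolP (i \in leaf_set t1)) => i1; last by rewrite mul0r mulr0.
case: (boolP (j \in leaf_set t2)) => j2; last by rewrite mul0r.
by move: ij; rewrite /= !inE i1 j2 orbT.
Qed.

Lemma tree_value_node0 t1 t2 : ordered_leaves (DNode t1 t2) ->
  tree_value (DNode t1 t2) 0 = tree_value t1 0 * tree_value t2 0.
Proof. exact: site_prod_node. Qed.

(** A pair of sites lies in the first child, in the second, or has one site in each; in the last
    case its weight factors through [V], [S] and [V]. *)
Lemma tree_value_node1 t1 t2 : DNode t1 t2 \in subtrees tbar ->
  tree_value (DNode t1 t2) 1 =
    tree_value t1 1 * tree_value t2 0 + tree_value t1 0 * tree_value t2 1 +
    \sum_(p < k) \sum_(q < k)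
      tree_value t1 p.+2 * nentry (S t1 t2) p q * tree_value t2 q.+2.
Proof.
move=> ts; have ot := subtrees_ordered obar ts.
have [s1 s2 n1 n2] := subtrees_children ts.
have dj := ordered_disjoint ot.
rewrite /tree_value -/nested_mx /=.
transitivity (\sum_i \sum_j
  (nested_mx t1 i j * site_prod (pred2 i j) t1 * site_prod pred0 t2 +
   site_prod pred0 t1 * (nested_mx t2 i j * site_prod (pred2 i j) t2) +
   \sum_(p < k) \sum_(q < k) nentry (V t1) i p * site_prod (pred1 i) t1 *
      nentry (S t1 t2) p q * (nentry (V t2) j q * site_prod (pred1 j) t2))).
  apply: eq_bigr => i _; apply: eq_bigr => j _.
  rewrite site_prod_node // mxE [X in X + _]mxE !mulrDl; congr (_ + _ + _).
  - case: (boolP ((i \notin leaf_set t1) || (j \notin leaf_set t1))) => [ij|].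
      by rewrite nested_mx_supp // !mul0r.
    rewrite negb_or !negbK => /andP[i1 j1]; rewrite mulrA; congr (_ * _).
    apply: eq_site_prod => l l2 /=.
    by rewrite -[l == i]negbK -[l == j]negbK !(contraTneq _ l2) // => ->;
       rewrite (disjointFr dj).
  - case: (boolP ((i \notin leaf_set t2) || (j \notin leaf_set t2))) => [ij|].
      by rewrite nested_mx_supp // !mul0r mulr0.
    rewrite negb_or !negbK => /andP[i1 j1]; rewrite mulrCA; congr (_ * _).
    apply: eq_site_prod => l l2 /=.
    by rewrite -[l == i]negbK -[l == j]negbK !(contraTneq _ l2) // => ->;
       rewrite (disjointFl dj).
  rewrite -nentryE nentryM exchange_big /= mulr_suml; apply: eq_bigr => q _.
  rewrite nentryM !mulr_suml; apply: eq_bigr => p _.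
  have -> : nentry (V t2)^T q j = nentry (V t2) j q by rewrite !nentryE mxE.
  case: (boolP (i \in leaf_set t1)) => i1; last by rewrite nentry_supp // !mul0r.
  case: (boolP (j \in leaf_set t2)) => j2; last first.
    by rewrite (nentry_supp q s2) // !mul0r !mulr0 mul0r.
  have -> : site_prod (pred2 i j) t1 = site_prod (pred1 i) t1.
    apply: eq_site_prod => l l1 /=.
    by rewrite -[l == j]negbK (contraTneq _ l1) ?orbF // => ->; rewrite (disjointFl dj).
  have -> : site_prod (pred2 i j) t2 = site_prod (pred1 j) t2.
    apply: eq_site_prod => l l1 /=.
    by rewrite -[l == i]negbK (contraTneq _ l1) ?orbF // => ->; rewrite (disjointFr dj).
  ring.
have split3 (f g h : 'I_d -> 'I_d -> C) : \sum_i \sum_j (f i j + g i j + h i j)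
    = \sum_i \sum_j f i j + \sum_i \sum_j g i j + \sum_i \sum_j h i j.
  by rewrite -!big_split; apply: eq_bigr => i _; rewrite -!big_split.
rewrite split3; congr (_ + _ + _).
- by rewrite mulr_suml; apply: eq_bigr => i _; rewrite mulr_suml.
- by rewrite mulr_sumr; apply: eq_bigr => i _; rewrite mulr_sumr.
under [LHS]eq_bigr => i _ do rewrite exchange_big.
rewrite exchange_big; apply: eq_bigr => p _ /=.
under [LHS]eq_bigr => i _ do rewrite exchange_big.
rewrite exchange_big; apply: eq_bigr => q _ /=.
rewrite !mulr_suml; apply: eq_bigr => i _; rewrite mulr_sumr.
by apply: eq_bigr => j _.
Qed.

Lemma tree_value_nodeSS t1 t2 q : DNode t1 t2 \in subtrees tbar ->
  DNode t1 t2 != tbar ->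
  tree_value (DNode t1 t2) q.+2 =
    \sum_(p < k) tree_value t1 p.+2 * nentry (T1 t1 t2) p q * tree_value t2 0 +
    \sum_(p < k) tree_value t1 0 * nentry (T2 t1 t2) p q * tree_value t2 p.+2.
Proof.
move=> ts tn; have ot := subtrees_ordered obar ts.
have [s1 s2 n1 n2] := subtrees_children ts.
have dj := ordered_disjoint ot.
rewrite /tree_value V_nested //.
under [LHS]eq_bigr => i _ do rewrite site_prod_node // nentryD mulrDl !nentryM.
rewrite big_split /=; congr (_ + _).
  under [LHS]eq_bigr => i _ do rewrite mulr_suml.
  rewrite exchange_big; apply: eq_bigr => p _; rewrite !mulr_suml.
  apply: eq_bigr => i _.
  case: (boolP (i \in leaf_set t1)) => i1; last by rewrite nentry_supp // !mul0r.
  have -> : site_prod (pred1 i) t2 = site_prod pred0 t2.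
    apply: eq_site_prod => l l1 /=.
    by apply: contraTF l1 => /eqP ->; rewrite (disjointFr dj).
  ring.
under [LHS]eq_bigr => i _ do rewrite mulr_suml.
rewrite exchange_big; apply: eq_bigr => p _; rewrite !mulr_sumr.
apply: eq_bigr => i _.
case: (boolP (i \in leaf_set t2)) => i1; last first.
  by rewrite (nentry_supp _ s2) // !mul0r mulr0.
have -> : site_prod (pred1 i) t1 = site_prod pred0 t1.
  apply: eq_site_prod => l l1 /=.
  by apply: contraTF l1 => /eqP ->; rewrite (disjointFl dj).
ring.
Qed.

Lemma op_ttnE t (c : 'I_(op_rank t)) : t \in subtrees tbar ->
  ttn_mx op_ttn t (tree_index m t) c = tree_value t (col_role t c).
Proof.
elim: t c => [l|t1 IH1 t2 IH2] c ts.
  have ln : DLeaf l != tbar by apply: contraNneq bar_node => <-.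
  rewrite [LHS]mxE /tree_value /leaf_value; case: col_role => [|[|q]].
  - by rewrite /site_prod big_set1.
  - by rewrite big1 // => i _; rewrite big1 // => j _; rewrite mxE mul0r.
  - rewrite (bigD1 l) //= big1 => [|i il]; last first.
      by rewrite nentry_supp ?mul0r // inE.
    by rewrite addr0 /site_prod big_set1 /= eqxx.
have [s1 s2 n1 n2] := subtrees_children ts.
have ot := subtrees_ordered obar ts.
rewrite /= tensmx_sumE.
under eq_bigr => a _ do under eq_bigr => b _ do
  rewrite IH1 // IH2 // mxE mxtens_indexK /=.
have r1 : op_rank t1 = k.+2 by rewrite /op_rank (negPf n1).
have r2 : op_rank t2 = k.+2 by rewrite /op_rank (negPf n2).
rewrite /col_role (negPf n1) (negPf n2) -/(col_role _ _).
rewrite (sum_role_transfer (tree_value t1) (tree_value t2)) //.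
(* Weighted one-site columns occur only away from the root, which is where the bases are nested. *)
have : (col_role (DNode t1 t2) c < 2)%N || (DNode t1 t2 != tbar).
  by rewrite /col_role; case: eqP; rewrite ?orbT.
case: col_role => [|[|q]] tn.
- by rewrite tree_value_node0.
- by rewrite tree_value_node1.
- by rewrite tree_value_nodeSS.
Qed.

Lemma site_prod_pair (i j : 'I_d) : (i < j)%N ->
  Defs.reshape (one_site A i *m one_site A j) m = site_prod (pred2 i j) tbar.
Proof.
move=> ij; rewrite /one_site kronM reshape_kron /site_prod full.
rewrite [RHS](eq_bigl xpredT) => [|l]; last by rewrite inE.
apply: eq_bigr => l _; congr (vec_mx_col _ _ _) => /=.
case: eqP => [->|] /=; last by rewrite mul1mx.
by case: eqP => [e|]; [rewrite e ltnn in ij | rewrite mulmx1].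
Qed.

Lemma reshape_pair_operator B : strictly_upper B ->
  Defs.reshape (pair_operator B A) m =
    \sum_i \sum_j B i j * site_prod (pred2 i j) tbar.
Proof.
move=> Bu; rewrite /Defs.reshape /pair_operator summxE; apply: eq_bigr => i _.
rewrite summxE big_mkcond; apply: eq_bigr => j _.
case: ltnP => ij; last by rewrite Bu ?mul0r.
by rewrite mxE -site_prod_pair.
Qed.

End Value.

Lemma has_ttno_nested : strictly_upper (nested_mx tbar) ->
  has_ttno tbar (pair_operator (nested_mx tbar) A) (2 + k)%N.
Proof.
move=> Bu; exists op_ttn; split.
  apply/eqP; rewrite eqn_leq; apply/andP; split.
    by apply/bigmax_leqP_seq => t _ _; rewrite /= /op_rank; case: ifP.
  (* The root has rank 1, so the maximum is attained at a proper subtree. *)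
  have [t s1 n1] : exists2 t, t \in subtrees tbar & t != tbar.
    case: tbar bar_node => // t1 t2 _; exists t1;
    by have [] := subtrees_children (subtrees_refl (DNode t1 t2)).
  have := @leq_bigmax_seq _ (subtrees tbar) xpredT op_rank t s1 isT.
  by rewrite {1}/op_rank (negPf n1).
have e1 : tree_dim N tbar = kron_dim N.
  rewrite tree_dimE // kron_dimE full; by apply: eq_bigl => i; rewrite inE.
have e2 : ttn_rank op_ttn tbar = 1%N by rewrite /= /op_rank eqxx.
exists (e1, e2) => m; rewrite castmxE /=.
have -> : cast_ord (esym e1) (vec_index m) = tree_index m tbar.
  by apply: val_inj; rewrite /= tree_index_vec.
by rewrite op_ttnE ?subtrees_refl // /col_role eqxx reshape_pair_operator.
Qed.

End TTNOfNested.

(** * Operator bounds *)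

Section OpBound.
Variable C : numClosedFieldType.

Lemma fsq_cols m n (A : 'M[C]_(m, n)) : fsq A = \sum_j fsq (col j A).
Proof.
by rewrite -fsq_tr fsq_rows; apply: eq_bigr => j _; rewrite -tr_col fsq_tr.
Qed.

(** After a unitary change of basis, the eigenvalue is the squared norm of a single column. *)
Lemma gram_eig_le_fsq m n (A : 'M[C]_(m, n)) j : gram_eig A j <= fsq A.
Proof.
have -> : fsq A = fsq (A *m (gram_basis A)^t*).
  by rewrite /fsq adjmxM trmxCK mulmxA -(mulmxA A) gram_basisKV mulmx1.
rewrite gram_eigE [leRHS]fsq_cols [col j _ in leLHS]colE mulmxA -colE.
rewrite (bigD1 j) //= lerDl.
by apply: sumr_ge0 => i _; exact: fsq_ge0.
Qed.

Lemma fsqM_le m n p (A : 'M[C]_(m, n)) (B : 'M[C]_(n, p)) :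
  fsq (A *m B) <= fsq A * fsq B.
Proof. by apply: fsq_le_eig => j; exact: gram_eig_le_fsq. Qed.

(** Cauchy-Schwarz, obtained from [fsqM_le] for a row times a column. *)
Lemma sum_scale_le (I : finType) (P : pred I) (a b : I -> C) :
  `|\sum_(i | P i) a i * b i| ^+ 2
    <= (\sum_(i | P i) `|a i| ^+ 2) * \sum_(i | P i) `|b i| ^+ 2.
Proof.
pose r : 'rV[C]_#|P| := \row_p a (enum_val p).
pose c : 'cV[C]_#|P| := \col_p b (enum_val p).
have e (F : I -> C) : \sum_(i | P i) F i = \sum_(p < #|P|) F (enum_val p).
  exact: big_enum_val.
rewrite !e; have := fsqM_le r c.
have -> : fsq (r *m c) = `|\sum_(p < #|P|) a (enum_val p) * b (enum_val p)| ^+ 2.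
  by rewrite fsqE !big_ord1 mxE; congr (`|_| ^+ 2); apply: eq_bigr => p _; rewrite !mxE.
have -> : fsq r = \sum_(p < #|P|) `|a (enum_val p)| ^+ 2.
  by rewrite fsqE big_ord1; apply: eq_bigr => p _; rewrite mxE.
have -> : fsq c = \sum_(p < #|P|) `|b (enum_val p)| ^+ 2 => [|//].
by rewrite fsqE; apply: eq_bigr => p _; rewrite big_ord1 mxE.
Qed.

Lemma fsq_sum_scale_le (I : finType) (P : pred I) (a : I -> C) m n
    (w : I -> 'M[C]_(m, n)) :
  fsq (\sum_(i | P i) a i *: w i)
    <= (\sum_(i | P i) `|a i| ^+ 2) * \sum_(i | P i) fsq (w i).
Proof.
rewrite fsqE; under [X in _ <= _ * X]eq_bigr do rewrite fsqE.
rewrite [X in _ <= _ * X]exchange_big mulr_sumr; apply: ler_sum => x _ /=.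
rewrite [X in _ <= _ * X]exchange_big mulr_sumr; apply: ler_sum => y _ /=.
rewrite summxE; under [X in `|X|]eq_bigr => i _ do rewrite mxE.
exact: sum_scale_le.
Qed.

(** A bound by [c] on the squared spectral norm. Testing on matrices, and not only on vectors, is
    what the Kronecker estimate uses. *)
Definition op_bound m n (c : C) (A : 'M[C]_(m, n)) :=
  forall p (X : 'M[C]_(n, p)), fsq (A *m X) <= c * fsq X.

Lemma op_boundP m n c (A : 'M[C]_(m, n)) :
  (forall v : 'cV[C]_n, fsq (A *m v) <= c * fsq v) -> op_bound c A.
Proof. by move=> Ac p X; apply: fsq_le_eig => j; exact: eig_le_fsq. Qed.

Lemma op_bound1 n : op_bound 1 (1%:M : 'M[C]_n).
Proof. by move=> p X; rewrite mul1mx mul1r. Qed.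

Lemma sum_mxtens (V : nmodType) m n (F : 'I_(m * n) -> V) :
  \sum_x F x = \sum_i \sum_j F (mxtens_index (i, j)).
Proof.
rewrite pair_bigA /= (reindex (@mxtens_index m n)) /=; last first.
  by exists (@mxtens_unindex m n) => ? _; rewrite ?mxtens_indexK ?mxtens_unindexK.
by apply: eq_bigr => -[a b] _.
Qed.

Lemma op_bound_tens m n p q c c' (A : 'M[C]_(m, n)) (B : 'M[C]_(p, q)) :
  0 <= c -> op_bound c A -> op_bound c' B -> op_bound (c * c') (A *t B).
Proof.
move=> c0 Ac Bc; apply: op_boundP => v.
(* Reshaping [v] to the matrix [W] turns the Kronecker product into A W B^T, so the two bounds apply
   one after the other. *)
pose W : 'M[C]_(n, q) := \matrix_(a, b) v (mxtens_index (a, b)) 0.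
have -> : fsq v = fsq W.
  rewrite !fsqE sum_mxtens; apply: eq_bigr => a _; apply: eq_bigr => b _.
  by rewrite big_ord1 mxE.
have -> : fsq ((A *t B) *m v) = fsq (A *m (W *m B^T)).
  rewrite !fsqE sum_mxtens; apply: eq_bigr => i _; apply: eq_bigr => j _.
  rewrite big_ord1 tensmx_sumE; congr (`|_| ^+ 2).
  rewrite mxE; apply: eq_bigr => a _; rewrite mxE mulr_sumr.
  by apply: eq_bigr => b _; rewrite !mxE -mulrA [B j b * _]mulrC.
apply: le_trans (Ac _ _) _; rewrite -mulrA ler_wpM2l //.
by rewrite -fsq_tr trmx_mul trmxK -[in leRHS]fsq_tr.
Qed.

Lemma op_bound_kron d (n : 'I_d -> nat) (B : forall i, 'M[C]_(n i)) (c : 'I_d -> C) :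
  (forall i, 0 <= c i) -> (forall i, op_bound (c i) (B i)) ->
  op_bound (\prod_i c i) (kron B).
Proof.
elim: d n B c => [|d IH] n B c c0 Bc /=; first by rewrite big_ord0; exact: op_bound1.
rewrite big_ord_recr /= mulrC; apply: op_bound_tens => //.
by apply: IH.
Qed.

End OpBound.

(** * Singular values and norms over the reals *)

Section SingularValues.
Variable R : realType.
Local Notation C := R[i].
Local Open Scope complex_scope.

Lemma count_gt_nth_sort (l : seq R) (k : nat) (x : R) : 0 <= x ->
  nth 0 (sort >=%R l) k <= x -> (count (fun y => (x < y)%R) l <= k)%N.
Proof.
move=> x0 lx; rewrite -(permP (permEl (perm_sort >=%R l))).
set s := sort _ l in lx *.
have ss : sorted >=%R s by apply: sort_sorted; exact: ge_total.
rewrite -(cat_take_drop k s) count_cat.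
have -> : count (fun y => (x < y)%R) (drop k s) = 0%N.
  apply/eqP; rewrite -leqn0 leqNgt -has_count; apply/hasPn => y /(nthP 0)[a].
  rewrite size_drop ltn_subRL nth_drop => ak <-; rewrite -leNgt.
  apply: le_trans lx.
  have geT : transitive (>=%R : rel R) by move=> b c f bc cf; exact: le_trans cf bc.
  have geR : reflexive (>=%R : rel R) by move=> b /=.
  apply: (sorted_leq_nth geT geR 0 ss); rewrite ?inE ?leq_addr //.
  by rewrite (leq_ltn_trans _ ak) ?leq_addr.
rewrite addn0; apply: leq_trans (count_size _ _) _; rewrite size_take.
by case: ltnP => // /ltnW.
Qed.

Section Mx.
Variables (m n : nat) (A : 'M[C]_(m, n)).

Lemma gram_eig_re j : gram_eig A j = (complex.Re (gram_eig A j))%:C.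
Proof. by rewrite RRe_real // ger0_real // gram_eig_ge0. Qed.

Lemma gram_eig_re_ge0 j : 0 <= complex.Re (gram_eig A j).
Proof. by have := gram_eig_ge0 A j; rewrite [X in 0 <= X]gram_eig_re ler0c. Qed.

(** [sigma] counts from 1, so [sigma k.+1] sits at position [k] of the decreasing list and at most
    [k] entries exceed it. *)
Lemma card_eig_sigma k (s : R) : 0 <= s -> sigma k.+1 A <= s ->
  (#|[set j | ((s ^+ 2)%:C < gram_eig A j)%R]| <= k)%N.
Proof.
move=> s0 /(count_gt_nth_sort s0); rewrite count_map => /(leq_trans _); apply.
rewrite -sum1_count -sum1_card big_enum_cond /=; apply/eq_leq/eq_bigl => j.
rewrite !inE gram_eig_re ltcR -[RHS](ltr_pXn2r (ltn0Sn 1)) ?nnegrE ?sqrtr_ge0 //.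
by rewrite sqr_sqrtr //; exact: gram_eig_re_ge0.
Qed.

Lemma spectral_norm_ge0 : 0 <= spectral_norm A.
Proof.
rewrite /spectral_norm /sigma /=; set l := singular_values A.
case: (ltnP 0 (size l)) => [l0|?]; last by rewrite nth_default.
have : nth 0 l 0 \in l by exact: mem_nth.
by rewrite mem_sort => /mapP[j _ ->]; exact: sqrtr_ge0.
Qed.

Lemma gram_eig_spectral j : gram_eig A j <= (spectral_norm A ^+ 2)%:C.
Proof.
have := card_eig_sigma spectral_norm_ge0 (lexx (sigma 1 A)).
rewrite leqn0 cards_eq0 => /eqP/setP/(_ j); rewrite !inE.
by rewrite gram_eig_re ltcR lecR => /negbT; rewrite -leNgt.
Qed.

Lemma op_bound_spectral : op_bound (spectral_norm A ^+ 2)%:C A.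
Proof. by move=> p X; apply: fsq_le_eig; exact: gram_eig_spectral. Qed.

Lemma spectral_norm_le (c : R) : 0 <= c ->
  (forall j, gram_eig A j <= (c ^+ 2)%:C) -> spectral_norm A <= c.
Proof.
move=> c0 Ac; rewrite /spectral_norm /sigma /=; set l := singular_values A.
(* A matrix without columns has an empty list, and its norm is the default 0. *)
case: (ltnP 0 (size l)) => [l0|?]; last by rewrite nth_default.
have : nth 0 l 0 \in l by exact: mem_nth.
rewrite mem_sort => /mapP[j _ ->].
rewrite -(ler_pXn2r (ltn0Sn 1)) ?nnegrE ?sqrtr_ge0 //.
rewrite sqr_sqrtr; last exact: gram_eig_re_ge0.
by rewrite -lecR -gram_eig_re.
Qed.

Lemma frobenius_norm_ge0 : 0 <= frobenius_norm A.
Proof. exact: sqrtr_ge0. Qed.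

Lemma frobenius_fsq : (frobenius_norm A ^+ 2)%:C = fsq A.
Proof.
have nn (z : C) : 0 <= Normc.normc z by case: z => a b; exact: sqrtr_ge0.
rewrite sqr_sqrtr; last by do 2 (apply: sumr_ge0 => ? _); rewrite exprn_ge0.
rewrite fsqE raddf_sum; apply: eq_bigr => i _ /=.
rewrite raddf_sum; apply: eq_bigr => j _ /=.
by rewrite rmorphXn.
Qed.

Lemma spectral_le_frobenius : spectral_norm A <= frobenius_norm A.
Proof.
apply: spectral_norm_le frobenius_norm_ge0 _ => j.
by rewrite frobenius_fsq gram_eig_le_fsq.
Qed.

End Mx.

Lemma spectral_norm_op m n (A : 'M[C]_(m, n)) (c : R) : 0 <= c ->
  op_bound (c ^+ 2)%:C A -> spectral_norm A <= c.
Proof. by move=> c0 Ac; apply: spectral_norm_le => // j; apply: eig_le_fsq. Qed.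

Section PairOperator.
Variables (d : nat) (n : 'I_d -> nat) (A : forall i : 'I_d, 'M[C]_(n i)).

Lemma op_bound_one_site i : op_bound (spectral_norm (A i) ^+ 2)%:C (one_site A i).
Proof.
pose c j := if j == i then (spectral_norm (A j) ^+ 2)%:C else 1 : C.
have -> : (spectral_norm (A i) ^+ 2)%:C = \prod_j c j.
  rewrite (bigD1 i) //= {1}/c eqxx big1 ?mulr1 // => j ji.
  by rewrite /c (negPf ji).
apply: op_bound_kron => j; rewrite /c; case: eqP => // _.
- by rewrite ler0c exprn_ge0 // spectral_norm_ge0.
- exact: op_bound_spectral.
- exact: op_bound1.
Qed.

Lemma pair_operatorB (B B' : 'M[C]_d) :
  pair_operator B A - pair_operator B' A = pair_operator (B - B') A.
Proof.
rewrite /pair_operator -sumrB; apply: eq_bigr => i _.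
rewrite -sumrB; apply: eq_bigr => j _.
by rewrite !mxE scalerBl.
Qed.

Lemma spectral_pair_operator (B : 'M[C]_d) :
  spectral_norm (pair_operator B A) <= frobenius_norm B *
    Num.sqrt (\sum_(i < d) \sum_(j < d | (i < j)%N)
      spectral_norm (A i) ^+ 2 * spectral_norm (A j) ^+ 2).
Proof.
set s := \sum_(i < d) _.
have sp i : 0 <= spectral_norm (A i) ^+ 2 by rewrite exprn_ge0 ?spectral_norm_ge0.
have s0 : 0 <= s by do 2 (apply: sumr_ge0 => ? _); rewrite mulr_ge0.
apply: spectral_norm_op; first by rewrite mulr_ge0 ?frobenius_norm_ge0 ?sqrtr_ge0.
move=> p X; rewrite exprMn (sqr_sqrtr s0) rmorphM /= frobenius_fsq.
(* One sum over pairs, with scalars B i j and the images of [X] under the products of one-site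
   operators, ready for Cauchy-Schwarz. *)
rewrite /pair_operator pair_big_dep mulmx_suml.
under eq_bigr => ij _ do rewrite -scalemxAl.
apply: le_trans (fsq_sum_scale_le _ _ _) _; rewrite -mulrA.
apply: ler_pM.
- by apply: sumr_ge0 => ? _; rewrite exprn_ge0.
- by apply: sumr_ge0 => ? _; rewrite fsq_ge0.
- rewrite fsqE pair_bigA big_mkcond; apply: ler_sum => ij _.
  by case: ifP => _ //; rewrite exprn_ge0.
pose w (i j : 'I_d) := (spectral_norm (A i) ^+ 2 * spectral_norm (A j) ^+ 2)%:C.
have -> : s%:C = \sum_(ij : 'I_d * 'I_d | true && (ij.1 < ij.2)%N) w ij.1 ij.2.
  rewrite -(pair_big_dep xpredT (fun i j : 'I_d => (i < j)%N) w) /s raddf_sum.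
  by apply: eq_bigr => i _; rewrite raddf_sum.
rewrite mulr_suml; apply: ler_sum => -[i j] _ /=; rewrite /w.
rewrite rmorphM /= -mulmxA -mulrA; apply: le_trans (op_bound_one_site _ _) _.
by rewrite ler_wpM2l ?ler0c // op_bound_one_site.
Qed.

End PairOperator.

(** * From the rectangular outer block to its padded form *)

Section OuterBlock.
Variables (d : nat) (t : dtree d).
Hypothesis ot : ordered_leaves t.
Local Notation D := (coord_proj C (leaf_set t)).
Local Notation E := (coord_emb C (~: leaf_set t)).

Lemma fsq_rowsub_leaf p (Y : 'M[C]_(d, p)) :
  fsq (rowsub (@leaf_at d t) Y) = fsq (D *m Y).
Proof.
rewrite !fsq_rows; under eq_bigr => a _ do rewrite row_rowsub.
rewrite (sum_leaf_at (fun i => fsq (row i Y)) ot) big_mkcond; apply: eq_bigr => i _ /=.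
case: ifPn => it.
  by congr fsq; apply/rowP => j; rewrite mxE [RHS]mxE coord_projlE it mul1r.
suff -> : row i (D *m Y) = 0 by rewrite fsq0.
by apply/rowP => j; rewrite [LHS]mxE coord_projlE (negPf it) mul0r mxE.
Qed.

Lemma coord_emb_proj : E *m E^T = 1%:M - D.
Proof.
apply/matrixP => i j; rewrite coord_embE !mxE inE.
by case: (altP (i =P j)) => [->|_]; case: (_ \in _); rewrite ?subr0 ?subrr.
Qed.

Lemma coord_emb_adj : E^t* = E^T.
Proof. by apply/matrixP => i j; rewrite !mxE conjC_nat. Qed.

Lemma fsq_mul_emb p (Z : 'M[C]_(p, d)) : fsq (Z *m E) = fsq (Z *m (1%:M - D)).
Proof.
have [Ph PP] := is_oprojC (coord_proj_oproj C (leaf_set t)).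
rewrite /fsq !adjmxM Ph coord_emb_adj -!mulmxA (mulmxA E) coord_emb_proj.
by rewrite (mulmxA (1%:M - D) (1%:M - D)) PP.
Qed.

Variable B : 'M[C]_d.

Lemma outer_blockE : outer_block B t = rowsub (@leaf_at d t) (B *m E).
Proof.
apply/matrixP => a b; rewrite !mxE (bigD1 (enum_val b)) //= !mxE eqxx mulr1.
rewrite big1 ?addr0 // => j jb; rewrite !mxE.
by case: eqP jb => [->|]; rewrite ?eqxx ?mulr0.
Qed.

Lemma fsq_outer_block : fsq (outer_block B t) = fsq (D *m B *m (1%:M - D)).
Proof. by rewrite outer_blockE fsq_rowsub_leaf mulmxA fsq_mul_emb. Qed.

(** The spectral norm in the gap condition is relaxed to the Frobenius norm, and the annihilator of
    the rectangular block is pulled back along the inclusion of the complementary coordinates. *)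
Lemma outer_low_rank (eps : R) k : 0 < eps ->
  sigma k.+1 (outer_block B t) <= eps * spectral_norm (outer_block B t) ->
  exists p (X : 'M[C]_(p, d)), (\rank X <= k)%N /\
    forall v : 'cV[C]_d, X *m v = 0 ->
      fsq (D *m B *m (1%:M - D) *m v)
        <= (eps ^+ 2)%:C * fsq (D *m B *m (1%:M - D)) * fsq v.
Proof.
move=> e0 sk; set O := outer_block B t in sk.
have s0 : 0 <= eps * frobenius_norm O by rewrite mulr_ge0 ?frobenius_norm_ge0 // ltW.
have /(card_eig_sigma s0) cO : sigma k.+1 O <= eps * frobenius_norm O.
  by apply: le_trans sk _; rewrite ler_pM2l // spectral_le_frobenius.
have [|X0 rX0 HX0] := @low_rank_annihilator _ _ _ O ((eps * frobenius_norm O) ^+ 2)%:C.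
  by rewrite ler0c exprn_ge0.
exists _, (X0 *m E^T); split.
  by apply: leq_trans (mxrankM_maxl _ _) _; apply: leq_trans cO.
move=> v; rewrite -(mulmxA X0) => /HX0.
rewrite exprMn rmorphM /= frobenius_fsq fsq_outer_block.
have -> : fsq (O *m (E^T *m v)) = fsq (D *m B *m (1%:M - D) *m v).
  rewrite /O outer_blockE !mul_rowsub_mx fsq_rowsub_leaf -!mulmxA (mulmxA E).
  by rewrite coord_emb_proj.
move=> /le_trans; apply; rewrite ler_wpM2l //.
  by rewrite mulr_ge0 ?fsq_ge0 // ler0c exprn_ge0 // ltW.
rewrite -fsq_tr trmx_mul trmxK fsq_mul_emb -[leRHS]fsq_tr.
exact/fsq_mulr_proj_le/is_oprojC/coord_proj_oproj.
Qed.

End OuterBlock.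
End SingularValues.

Theorem theorem4p5 (R : realType) :
  exists C : R, 0 < C /\
  forall (d : nat) (tbar : dtree d) (beta : 'M[R[i]]_d) (eps : R) (k : nat),
    (2 <= d)%N ->
    dimension_tree tbar ->
    strictly_upper beta ->
    0 < eps ->
    (1 <= k)%N ->
    (forall t : dtree d, t \in subtrees tbar -> ~~ is_leaf t -> t != tbar ->
       sigma k.+1 (outer_block (beta + beta^T) t)
         <= eps * spectral_norm (outer_block (beta + beta^T) t)) ->
    exists betak : 'M[R[i]]_d,
      [/\ strictly_upper betak,
          has_hss tbar betak k,
          frobenius_norm (beta - betak)
            <= C * (height tbar)%:R * Num.sqrt k%:R * frobenius_norm beta * eps
        & forall (n : 'I_d -> nat) (A : forall i : 'I_d, 'M[R[i]]_(n i)),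
            has_ttno tbar (pair_operator betak A) (2 + k)%N /\
            spectral_norm (pair_operator beta A - pair_operator betak A)
              <= C * (height tbar)%:R * Num.sqrt k%:R * frobenius_norm beta
                 * Num.sqrt (\sum_(i < d) \sum_(j < d | (i < j)%N)
                     spectral_norm (A i) ^+ 2 * spectral_norm (A j) ^+ 2)
                 * eps].
Proof.
exists 4; split=> // d tbar beta eps k d2 /andP[obar /eqP full] bu e0 k0 sk.
pose e : R[i] := (real_complex R (eps ^+ 2)).
have e_ge0 : 0 <= e by rewrite ler0c exprn_ge0 // ltW.
have bar_node : ~~ is_leaf tbar.
  apply/negP; case: tbar full {obar sk} => // l full _.
  by move: d2; rewrite -(card_ord d) -cardsT -full cards1.
pose P := tree_proj beta e.
pose V t := factl k (P t).
pose S t1 t2 := factr k (P t1) *m beta *m (factr k (P t2))^T.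
(* Nestedness gives V t = (P t1 + P t2) V t; factoring each [P] through its basis exhibits these
   coefficients. *)
pose T1 t1 t2 := factr k (P t1) *m V (DNode t1 t2).
pose T2 t1 t2 := factr k (P t2) *m V (DNode t1 t2).
have low t : t \in subtrees tbar -> ~~ is_leaf t -> t != tbar ->
    exists p (X : 'M[R[i]]_(p, d)), (\rank X <= k)%N /\
    forall v : 'cV_d, X *m v = 0 ->
      fsq (outer beta t *m v) <= e * fsq (outer beta t) * fsq v.
  move=> ts tl tn; apply: outer_low_rank => //; last exact: sk.
  exact: subtrees_ordered ts.
have oP t : t \in subtrees tbar -> is_oproj (P t).
  by move=> ts; apply: tree_proj_oproj => //; exact: subtrees_ordered ts.
have rP t : t \in subtrees tbar -> t != tbar -> (\rank (P t) <= k)%N.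
  exact: rank_tree_proj.
have VK t : t \in subtrees tbar -> t != tbar -> V t *m factr k (P t) = P t.
  by move=> ts tn; apply: factlrK; [case: (oP t ts) | exact: rP].
have V_supp t : t \in subtrees tbar -> t != tbar ->
    coord_proj R[i] (leaf_set t) *m V t = V t.
  by move=> ts tn; apply/mul_factl/tree_projl => //; exact: subtrees_ordered ts.
have V_nested t1 t2 : DNode t1 t2 \in subtrees tbar -> DNode t1 t2 != tbar ->
    V (DNode t1 t2) = V t1 *m T1 t1 t2 + V t2 *m T2 t1 t2.
  move=> ts tn; have [s1 s2 n1 n2] := subtrees_children ts.
  rewrite /T1 /T2 !(mulmxA (V _) (factr _ _)) !VK // -mulmxDl.
  apply/esym/mul_factl/tree_proj_nested => //; exact: subtrees_ordered ts.
have BE t1 t2 : DNode t1 t2 \in subtrees tbar ->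
    P t1 *m beta *m (P t2)^T = V t1 *m S t1 t2 *m (V t2)^T.
  move=> ts; have [s1 s2 n1 n2] := subtrees_children ts.
  by rewrite -{1}(VK t1) // -{1}(VK t2) // trmx_mul /S !mulmxA.
have nE t : t \in subtrees tbar -> tree_approx beta e t = nested_mx V S t.
  elim: t => [//|t1 IH1 t2 IH2] ts; have [s1 s2 _ _] := subtrees_children ts.
  by rewrite /= IH1 // IH2 // BE.
set betak := tree_approx beta e tbar.
have betakE : betak = nested_mx V S tbar by apply/nE/subtrees_refl.
have bku : strictly_upper betak by move=> i j; apply: tree_approx_upper.
have h0 : (0 < height tbar)%N by case: (tbar) bar_node.
set bnd := 4 * (height tbar)%:R * Num.sqrt k%:R * frobenius_norm beta * eps.
have bnd0 : 0 <= bnd.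
  by rewrite !mulr_ge0 ?sqrtr_ge0 // ltW.
have err : frobenius_norm (beta - betak) <= bnd.
  rewrite -(ler_pXn2r (ltn0Sn 1)) ?nnegrE ?frobenius_norm_ge0 // -lecR frobenius_fsq.
  apply: le_trans (fsq_approx_err bu e_ge0 obar k0 low full) _.
  have bs : fsq (beta + beta^T) <= (4 * frobenius_norm beta ^+ 2)%:C%C.
    apply: le_trans (fsqD_le _ _) _; rewrite fsq_tr rmorphM /= frobenius_fsq rmorph_nat.
    by rewrite le_eqVlt; apply/orP; left; apply/eqP; ring.
  apply: (@le_trans _ _ (real_complex R
     (eps ^+ 2 * (4 * frobenius_norm beta ^+ 2) *+ (height tbar).+1 *+ (k + k)))).
    rewrite 2!rmorphMn rmorphM /= lerMn2r lerMn2r !orbA.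
    by apply/orP; right; rewrite ler_wpM2l.
  rewrite lecR /bnd; set f := frobenius_norm beta; set h := height tbar.
  have -> : (4 * h%:R * Num.sqrt k%:R * f * eps) ^+ 2
     = (4 * (h * h * k))%:R * (eps ^+ 2 * (4 * f ^+ 2)).
    by rewrite !natrM -[k%:R in RHS](sqr_sqrtr (ler0n R k)); ring.
  rewrite -mulrnA -[X in X <= _]mulr_natl; apply: ler_wpM2r.
    by rewrite !mulr_ge0 ?exprn_ge0 ?frobenius_norm_ge0 // ltW.
  (* The constant 4 reduces to 2k (h + 1) <= 4 h^2 k, which holds because the height is at least
     1. *)
  rewrite ler_nat; have : (0 < h)%N by []; nia.
exists betak; split=> //.
  apply: (@has_hss_nested _ _ _ _ _ V S T1 T2) => // t1 t2 ts.
  by rewrite tree_approx_block // BE.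
move=> n A; split.
  rewrite betakE; apply: (@has_ttno_nested _ _ _ _ V S T1 T2) => //.
  by rewrite -betakE.
rewrite pair_operatorB; apply: le_trans (spectral_pair_operator _ _) _.
by rewrite mulrAC ler_wpM2r ?sqrtr_ge0.
Qed.
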